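(* Let $\mathbb S=R[X;\boldsymbol\alpha,\boldsymbol\delta]$ be a skew polynomial ring of bijective type over a well-ordered set of variables, and suppose that $\delta_\kappa(\mathcal Z(R)T_\kappa)=0$ for every $\kappa<\Omega$. Let $A$ be an essentially special subextension of $\mathbb S$. Then every uniform (respectively, essential) left ideal $L$ of $R$ gives a uniform (respectively, essential) left ideal $A\cap AL$ of $A$, and $\mathcal Z(A)=A\cap\mathcal Z(R)T$. Moreover, if $R$ has enough uniform left ideals, then so does $A$, and $\operatorname{udim}(A)=\operatorname{udim}(R)$.
   Context: Setting (M): $R$ a ring, $\Omega$ an ordinal, $X=\{x_s:s<\Omega\}$; $T_\kappa$ the standard terms $x_{s_1}\cdots x_{s_n}$ ($n\in\mathbb N$, $s_1\le\cdots\le s_n<\kappa$), $T=T_\Omega$; $\mathbb S$ has subrings $\mathbb S_\kappa$ ($\kappa\le\Omega$) with $\mathbb S_0=R$, $\mathbb S_\Omega=\mathbb S$, $\mathbb S_\kappa$ free as left $R$-module on $T_\kappa$, $\mathbb S_{\kappa+1}=\mathbb S_\kappa[x_\kappa;\alpha_\kappa,\delta_\kappa]$ an Ore extension (free left $\mathbb S_\kappa$-module on $\{x_\kappa^n\}$, $x_\kappa p=\alpha_\kappa(p)x_\kappa+\delta_\kappa(p)$) with $\alpha_\kappa$ a ring automorphism and $\delta_\kappa$ an $\alpha_\kappa$-derivation of $\mathbb S_\kappa$, and $\mathbb S_\kappa=\bigcup_{\eta<\kappa}\mathbb S_\eta$ for limit $\kappa$. $\mathcal Z(R)T_\kappa$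 is the set of elements of $\mathbb S_\kappa$ all of whose coefficients w.r.t. $T_\kappa$ lie in the left singular ideal $\mathcal Z(R)$. Univariate notions (for a ring $S\supseteq R$ free as left $R$-module, $x$ an Ore variable over $S$, $\deg_x$ the $x$-degree): for a subring $A\supseteq R$ of $S[x;\alpha,\delta]$, $\operatorname{Deg}_x(A)=\{\deg_xf:0\ne f\in A\}$, $d_A=\gcd(\operatorname{Deg}_x(A)\setminus\{0\})$ if $A\not\subseteq S$, else $0$. $A$ is a special subextension if $A=\sum_m(A\cap Sx^m)$, $\operatorname{Deg}_x(A)=d_A\mathbb N$, and for each $0\ne m\in\operatorname{Deg}_x(A)$ there exist $\lambda_m=\upsilon_mx^m\in A$ with $\upsilon_m$ regular in $S$, a subring $B_m$ with $R\subseteq B_m\subseteq A\cap S$, and an automorphism $\alpha_{(m)}$ of $B_m$ with $\deg_x(\lambda_mp-\alpha_{(m)}(p)\lambda_m)<m$ for $p\in B_m$, and for every $q\in S$ with $qx^m\in A$ some $u\in B_m$ regular in $S$ with $uqx^m\in B_m\lambda_m$; for $m=0$: $\lambda_0=1$, $B_0=A\cap S$, $\alpha_{(0)}=\mathrm{id}$. A subring $A$ of a ring $B$ is nicely essential if for every finite set $E\subseteq B$ of non-zero elements there is $a\in A$ with $0\ne ax\in A$ for all $x\in E$. Essentially special subextension of $\mathbb S$ (defined by induction on $\Omega$): if $\Omega=0$, a nicely essential subring of $R$ containing... i.e. any nicely essential subring $A$ of $R$; if $\Omega$ is a limit ordinal, a union $A=\bigcup_{\kappa\in\Lambda}A_\kappa$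 of an increasing family, $\Lambda\subseteq\Omega$, where each $A_\kappa$ is an essentially special subextension of $\mathbb S_\kappa$; if $\Omega=\kappa+1$, a nicely essential subring $A$ of some special subextension $\widetilde A$ of $\mathbb S=\mathbb S_\kappa[x_\kappa;\alpha_\kappa,\delta_\kappa]$ (viewed as univariate Ore extension over $S=\mathbb S_\kappa$) such that, for every $m\in\operatorname{Deg}_{x_\kappa}(\widetilde A)$, the attached ring $B_m$ is an essentially special subextension of $\mathbb S_\kappa$. $\operatorname{udim}$ is left uniform dimension (possibly infinite); enough uniform left ideals means every non-zero left ideal contains a uniform left ideal. *)

(* Defs.v *)
From HB Require Import structures.
From mathcomp Require Import all_boot all_order all_algebra.
From Stdlib Require Import ClassicalEpsilon.
Set Implicit Arguments. Unset Strict Implicit. Unset Printing Implicit Defensive.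
Import Order.TTheory GRing.Theory.
Local Open Scope ring_scope.

Section Defs.
Variables (S : nzRingType).

Definition subring (A : S -> Prop) : Prop :=
  A 1 /\ (forall a b, A a -> A b -> A (a - b)) /\ (forall a b, A a -> A b -> A (a * b)).

Definition lideal (A L : S -> Prop) : Prop :=
  (forall l, L l -> A l) /\ L 0 /\ (forall l1 l2, L l1 -> L l2 -> L (l1 + l2)) /\
  (forall a l, A a -> L l -> L (a * l)).

Definition nonzero (L : S -> Prop) : Prop := exists l, L l /\ l <> 0.

Definition essential_lideal (A L : S -> Prop) : Prop :=
  lideal A L /\ forall K, lideal A K -> nonzero K -> nonzero (fun s => K s /\ L s).

Definition uniform_lideal (A L : S -> Prop) : Prop :=
  lideal A L /\ nonzero L /\
  forall L1 L2, lideal A L1 -> lideal A L2 -> (forall s, L1 s -> L s) ->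
    (forall s, L2 s -> L s) -> nonzero L1 -> nonzero L2 ->
    nonzero (fun s => L1 s /\ L2 s).

Definition Zsing (A : S -> Prop) (a : S) : Prop :=
  A a /\ essential_lideal A (fun b => A b /\ b * a = 0).

Definition enough_uniform (A : S -> Prop) : Prop :=
  forall K, lideal A K -> nonzero K ->
    exists U, uniform_lideal A U /\ forall s, U s -> K s.

Definition udim_ge (A : S -> Prop) (n : nat) : Prop :=
  exists L : 'I_n -> S -> Prop,
    (forall i, lideal A (L i) /\ nonzero (L i)) /\
    forall v : 'I_n -> S, (forall i, L i (v i)) -> \sum_(i < n) v i = 0 ->
      forall i, v i = 0.

Definition is_udim (A : S -> Prop) (d : option nat) : Prop :=
  match d with
  | Some n => udim_ge A n /\ ~ udim_ge A n.+1
  | None => forall n, udim_ge A n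
  end.

Definition udim (A : S -> Prop) : option nat :=
  epsilon (inhabits None) (is_udim A).

Definition nicely_essential (A B : S -> Prop) : Prop :=
  subring A /\ (forall a, A a -> B a) /\
  forall E : seq S, (forall e, e \in E -> B e /\ e <> 0) ->
    exists a, A a /\ forall e, e \in E -> A (a * e) /\ a * e <> 0.

Definition AL (A L : S -> Prop) (f : S) : Prop :=
  exists (as_ ls : seq S), size as_ = size ls /\ (forall a, a \in as_ -> A a) /\
    (forall l, l \in ls -> L l) /\ f = \sum_(p <- zip as_ ls) p.1 * p.2.

Definition ring_aut_on (P : S -> Prop) (f : S -> S) : Prop :=
  (forall a, P a -> P (f a)) /\
  (forall a b, P a -> P b -> f (a + b) = f a + f b) /\
  (forall a b, P a -> P b -> f (a * b) = f a * f b) /\ f 1 = 1 /\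
  (forall a b, P a -> P b -> f a = f b -> a = b) /\
  (forall b, P b -> exists a, P a /\ f a = b).

Definition regular_in (P : S -> Prop) (u : S) : Prop :=
  P u /\ forall s, P s -> (s * u = 0 -> s = 0) /\ (u * s = 0 -> s = 0).

Definition is_gcd_set (P : nat -> Prop) (g : nat) : Prop :=
  (forall n, P n -> (g %| n)%N) /\
  (forall e, (forall n, P n -> (e %| n)%N) -> (e %| g)%N).

Variables (d : Order.disp_t) (I : orderType d) (Rp : S -> Prop) (x : I -> S).

Definition term (t : seq I) : S := \prod_(s <- t) x s.

Definition std (P : I -> bool) (t : seq I) : bool :=
  sorted (fun a b : I => (a <= b)%O) t && all P t.

(* elements that are left C-combinations of standard terms in variables
   satisfying P; with C = R and P = (< kappa) this is S_kappa, with
   C = Z(R) it is Z(R)T_kappa *)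
Definition lspan (C : S -> Prop) (P : I -> bool) (f : S) : Prop :=
  exists (ts : seq (seq I)) (rs : seq S), size rs = size ts /\
    (forall t, t \in ts -> std P t) /\ (forall r, r \in rs -> C r) /\
    f = \sum_(p <- zip rs ts) p.1 * term p.2.

(* cut kappa <= Omega: Some k is the ordinal k, None is Omega *)
Definition below (c : option I) (s : I) : bool :=
  if c is Some k then (s < k)%O else true.

Definition Sk (k : I) : S -> Prop := lspan Rp (fun s => (s < k)%O).
Definition Sk1 (k : I) : S -> Prop := lspan Rp (fun s => (s <= k)%O).

Definition xpoly (k : I) (ps : seq S) : S := \sum_(i < size ps) ps`_i * x k ^+ i.

Definition xdeg (k : I) (f : S) (n : nat) : Prop :=
  exists ps, size ps = n.+1 /\ (forall p, p \in ps -> Sk k p) /\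
    last 0 ps <> 0 /\ f = xpoly k ps.

Definition deg_lt (k : I) (f : S) (m : nat) : Prop :=
  exists ps, (size ps <= m)%N /\ (forall p, p \in ps -> Sk k p) /\ f = xpoly k ps.

Definition Deg (k : I) (A : S -> Prop) (n : nat) : Prop :=
  exists f, A f /\ f <> 0 /\ xdeg k f n.

Definition dA_rel (k : I) (A : S -> Prop) (g : nat) : Prop :=
  ((forall f, A f -> Sk k f) /\ g = 0%N) \/
  (~ (forall f, A f -> Sk k f) /\ is_gcd_set (fun n => Deg k A n /\ n <> 0%N) g).

Definition special (k : I) (At : S -> Prop) (B : nat -> S -> Prop) : Prop :=
  subring At /\ (forall r, Rp r -> At r) /\ (forall f, At f -> Sk1 k f) /\
  (forall f, At f -> exists ps : seq S, (forall p, p \in ps -> Sk k p) /\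
     f = xpoly k ps /\ forall i, At (ps`_i * x k ^+ i)) /\
  (exists g, dA_rel k At g /\ forall n, Deg k At n <-> (g %| n)%N) /\
  (forall m, Deg k At m -> m <> 0%N ->
     exists (ups : S) (alm : S -> S),
       regular_in (Sk k) ups /\ At (ups * x k ^+ m) /\
       subring (B m) /\ (forall r, Rp r -> B m r) /\
       (forall b, B m b -> At b /\ Sk k b) /\
       ring_aut_on (B m) alm /\
       (forall p, B m p ->
          deg_lt k (ups * x k ^+ m * p - alm p * (ups * x k ^+ m)) m) /\
       (forall q, Sk k q -> At (q * x k ^+ m) ->
          exists u, B m u /\ regular_in (Sk k) u /\
            exists b, B m b /\ u * q * x k ^+ m = b * (ups * x k ^+ m))) /\
  (forall f, B 0%N f <-> At f /\ Sk k f).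

Inductive ess_special : option I -> (S -> Prop) -> Prop :=
| ess_zero c A :
    (forall s, ~~ below c s) -> nicely_essential A Rp -> ess_special c A
| ess_limit c A (Lam : I -> Prop) (F : I -> S -> Prop) :
    (exists s, below c s) ->
    (forall s, below c s -> exists t, below c t /\ (s < t)%O) ->
    (forall e, Lam e -> below c e) -> (exists e, Lam e) ->
    (forall e e', Lam e -> Lam e' -> (e <= e')%O -> forall f, F e f -> F e' f) ->
    (forall e, Lam e -> ess_special (Some e) (F e)) ->
    (forall f, A f <-> exists e, Lam e /\ F e f) ->
    ess_special c A
| ess_succ c k A At (B : nat -> S -> Prop) :
    (forall s, below c s = (s <= k)%O) ->
    special k At B -> nicely_essential A At ->
    (forall m, Deg k At m -> ess_special (Some k) (B m)) ->
    ess_special c A.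

Variables (alpha delta : I -> S -> S).

Definition skew_poly_bijective : Prop :=
  well_founded (fun a b : I => (a < b)%O) /\
  subring Rp /\
  (forall f, lspan Rp predT f) /\
  (forall (ts : seq (seq I)) (rs : seq S), uniq ts -> (forall t, t \in ts -> std predT t) ->
     (forall r, r \in rs -> Rp r) -> size rs = size ts ->
     \sum_(p <- zip rs ts) p.1 * term p.2 = 0 -> forall r, r \in rs -> r = 0) /\
  (forall c, subring (lspan Rp (below c))) /\
  (* S_{k+1} = S_k[x_k; alpha_k, delta_k] *)
  (forall k : I,
     ring_aut_on (Sk k) (alpha k) /\
     (forall p, Sk k p -> Sk k (delta k p)) /\
     (forall p q, Sk k p -> Sk k q -> delta k (p + q) = delta k p + delta k q) /\
     (forall p q, Sk k p -> Sk k q ->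
        delta k (p * q) = alpha k p * delta k q + delta k p * q) /\
     (forall p, Sk k p -> x k * p = alpha k p * x k + delta k p) /\
     (forall f, Sk1 k f -> exists ps, (forall p, p \in ps -> Sk k p) /\ f = xpoly k ps) /\
     (forall ps, (forall p, p \in ps -> Sk k p) -> xpoly k ps = 0 ->
        forall p, p \in ps -> p = 0)).

End Defs.

(* Main.v *)
(* For f in S, write Z f if f is killed on the left by an essential left ideal
   of R; this says that f lies in Z(R)T.  If Z f fails, comparing leading terms
   variable by variable gives a non-zero r in R such that y r f <> 0 whenever
   y r <> 0 ([nonsing_all]).  So the essential left ideals met in the proof
   cannot kill a multiple of an element outside Z(R)T, while on Z(R)T the
   derivations vanish and multiplication by x_k behaves like a graded operation.

   For a special subextension A~ and an essential L, each f either has a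
   non-zero multiple with Z, which is pushed into A~L one homogeneous term at a
   time, or has none, and then the terms are pushed into A~L from the top degree
   downwards, the multipliers being kept from killing f by the element r above.
   For a uniform L, two elements f, g of A~L are compared by induction on
   deg f + deg g: after multiplying them to have equal leading terms, the left
   annihilator of one multiple c p of g is contained in that of the
   corresponding multiple c w f, so that a common multiple of f and the
   difference c p - c w f yields a common multiple of f and g.
   Both properties pass to nicely essential subrings and to directed unions.

   The singular ideal, the enough-uniform property and the uniform dimension
   follow: S is flat over R on the right, so independent left ideals of R stay
   independent in S, and R has a maximal independent family of cyclic uniform
   left ideals, whose sum is essential. *)
Require Import Defs.
From HB Require Import structures.
From mathcomp Require Import all_boot all_order all_algebra.
From mathcomp Require Import boolp classical_sets.
From Stdlib Require Import ClassicalEpsilon.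
Set Implicit Arguments. Unset Strict Implicit. Unset Printing Implicit Defensive.
Import Order.TTheory GRing.Theory.
Local Open Scope ring_scope.

(** * Left ideals of subrings *)

Section Subrings.
Variable S : nzRingType.
Implicit Types (A B L : S -> Prop).

Lemma subring1 A : subring A -> A 1. Proof. by case. Qed.
Lemma subringB A a b : subring A -> A a -> A b -> A (a - b).
Proof. by case=> _ [h _]; apply: h. Qed.
Lemma subringM A a b : subring A -> A a -> A b -> A (a * b).
Proof. by case=> _ [_ h]; apply: h. Qed.
Lemma subring0 A : subring A -> A 0.
Proof. by move=> sA; rewrite -(subrr 1); apply: subringB => //; apply: subring1. Qed.
Lemma subringN A a : subring A -> A a -> A (- a).
Proof. by move=> sA Aa; rewrite -sub0r; apply: subringB => //; apply: subring0. Qed.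
Lemma subringD A a b : subring A -> A a -> A b -> A (a + b).
Proof. by move=> sA Aa Ab; rewrite -[b]opprK; apply: subringB => //; apply: subringN. Qed.
Lemma subring_sum A (J : Type) (r : seq J) (Q : pred J) (F : J -> S) :
  subring A -> (forall j, Q j -> A (F j)) -> A (\sum_(j <- r | Q j) F j).
Proof.
move=> sA h; apply: big_ind => //; first exact: subring0.
by move=> *; apply: subringD.
Qed.

Lemma lidealS A L l : lideal A L -> L l -> A l.
Proof. by case=> h _; apply: h. Qed.
Lemma lideal0 A L : lideal A L -> L 0.
Proof. by case=> _ []. Qed.
Lemma lidealD A L l l' : lideal A L -> L l -> L l' -> L (l + l').
Proof. by case=> _ [_ [h _]]; apply: h. Qed.
Lemma lidealM A L a l : lideal A L -> A a -> L l -> L (a * l).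
Proof. by case=> _ [_ [_ h]]; apply: h. Qed.
Lemma lidealN A L l : subring A -> lideal A L -> L l -> L (- l).
Proof.
move=> sA iL Ll; rewrite -mulN1r; apply: (lidealM iL) _ Ll.
by apply: subringN => //; apply: subring1.
Qed.
Lemma lideal_sum A L (J : eqType) (r : seq J) (F : J -> S) :
  lideal A L -> (forall j, j \in r -> L (F j)) -> L (\sum_(j <- r) F j).
Proof.
move=> iL h; rewrite big_seq; apply: big_ind => //; first exact: (lideal0 iL).
by move=> *; apply: (lidealD iL).
Qed.
Lemma lidealT A : subring A -> lideal A A.
Proof.
move=> sA; split=> //; split; first exact: subring0.
by split=> *; [apply: subringD | apply: subringM].
Qed.
Lemma lidealI A L L' : lideal A L -> lideal A L' -> lideal A (fun s => L s /\ L' s).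
Proof.
move=> iL iL'; split=> [l [/(lidealS iL)]//|]; split; first by split; [apply: (lideal0 iL) | apply: (lideal0 iL')].
by split=> [l l' [? ?] [? ?]|a l Aa [? ?]]; split;
  [apply: (lidealD iL) | apply: (lidealD iL') | apply: (lidealM iL) | apply: (lidealM iL')].
Qed.
Lemma lideal_cyc A f : subring A -> A f -> lideal A (fun s => exists2 a, A a & s = a * f).
Proof.
move=> sA Af; split; first by move=> _ [a Aa ->]; apply: subringM.
split; first by exists 0; [apply: subring0 | rewrite mul0r].
split=> [_ _ [a Aa ->] [b Ab ->]|a _ Aa [b Ab ->]].
  by exists (a + b); [apply: subringD | rewrite mulrDl].
by exists (a * b); [apply: subringM | rewrite mulrA].
Qed.

Lemma cyc_self A f : subring A -> exists2 a, A a & f = a * f.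
Proof. by move=> sA; exists 1; [apply: subring1 | rewrite mul1r]. Qed.

(** Cyclic left ideals suffice as test objects, since every non-zero left ideal contains one. *)
Lemma essential_elt A L : subring A -> essential_lideal A L <->
  lideal A L /\ forall f, A f -> f <> 0 -> exists2 a, A a & a * f <> 0 /\ L (a * f).
Proof.
move=> sA; split=> [[iL eL]|[iL eL]]; split=> //.
  move=> f Af f0; have [s [[[a Aa ->] Lf] n0]] := eL _ (lideal_cyc sA Af)
    (ex_intro _ f (conj (cyc_self f sA) f0)).
  by exists a.
move=> K iK [f [Kf f0]]; have [a Aa [n0 Laf]] := eL f (lidealS iK Kf) f0.
by exists (a * f); split=> //; split=> //; apply: (lidealM iK).
Qed.

Lemma uniform_elt A L : subring A -> uniform_lideal A L <->
  [/\ lideal A L, nonzero L & forall f g, L f -> L g -> f <> 0 -> g <> 0 ->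
     exists a b, [/\ A a, A b, a * f = b * g & a * f <> 0]].
Proof.
move=> sA; split=> [[iL [nL uL]]|[iL nL uL]]; split=> //.
  move=> f g Lf Lg f0 g0.
  have [s [[[a Aa sa] [b Ab sb]] n0]] := uL _ _ (lideal_cyc sA (lidealS iL Lf))
     (lideal_cyc sA (lidealS iL Lg))
     (fun s '(ex_intro2 a Aa e) => eq_ind_r L (lidealM iL Aa Lf) e)
     (fun s '(ex_intro2 a Aa e) => eq_ind_r L (lidealM iL Aa Lg) e)
     (ex_intro _ f (conj (cyc_self f sA) f0)) (ex_intro _ g (conj (cyc_self g sA) g0)).
  by exists a, b; split=> //; rewrite -sa.
split=> // L1 L2 i1 i2 s1 s2 [f [Lf f0]] [g [Lg g0]].
have [a [b [Aa Ab e n0]]] := uL f g (s1 _ Lf) (s2 _ Lg) f0 g0.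
exists (a * f); split=> //; split; first exact: (lidealM i1).
by rewrite e; apply: (lidealM i2).
Qed.

Lemma essentialI A L L' : subring A -> essential_lideal A L -> essential_lideal A L' ->
  essential_lideal A (fun s => L s /\ L' s).
Proof.
move=> sA /(essential_elt _ sA)[iL eL] /(essential_elt _ sA)[iL' eL'].
apply/(essential_elt _ sA); split; first exact: lidealI.
move=> f Af f0; have [a Aa [n0 Laf]] := eL f Af f0.
have [b Ab [n1 Lbaf]] := eL' (a * f) (subringM sA Aa Af) n0.
exists (b * a); first exact: subringM.
by rewrite -mulrA; split=> //; split=> //; apply: (lidealM iL).
Qed.

Lemma essentialT A : subring A -> essential_lideal A A.
Proof.
move=> sA; apply/(essential_elt _ sA); split; first exact: lidealT.
by move=> f Af f0; exists 1; rewrite ?mul1r //; apply: subring1.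
Qed.

Lemma AL_zero A L : AL A L 0.
Proof. by exists [::], [::]; rewrite big_nil. Qed.

Lemma AL_cons A L a l f : A a -> L l -> AL A L f -> AL A L (a * l + f).
Proof.
move=> Aa Ll [as_ [ls [sz [hA [hL ->]]]]]; exists (a :: as_), (l :: ls).
split; first by rewrite /= sz.
split; first by move=> b; rewrite inE => /orP[/eqP->//|/hA].
split; first by move=> b; rewrite inE => /orP[/eqP->//|/hL].
by rewrite /= big_cons.
Qed.

Lemma AL_ind A L (P : S -> Prop) : P 0 ->
  (forall a l f, A a -> L l -> AL A L f -> P f -> P (a * l + f)) ->
  forall f, AL A L f -> P f.
Proof.
move=> P0 Pc f [as_ [ls [sz [hA [hL ->]]]]].
elim: as_ ls sz hA hL => [|a as_ IH] [|l ls] //= sz hA hL; first by rewrite big_nil.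
have hA' b : b \in as_ -> A b by move=> hb; apply: hA; rewrite inE hb orbT.
have hL' b : b \in ls -> L b by move=> hb; apply: hL; rewrite inE hb orbT.
have sz' : size as_ = size ls by case: sz.
rewrite big_cons; apply: Pc => //=; [by apply: hA; rewrite mem_head|by apply: hL; rewrite mem_head| |exact: IH].
by exists as_, ls.
Qed.

Lemma AL_mul1 A L a l : A a -> L l -> AL A L (a * l).
Proof. by move=> Aa Ll; rewrite -[_ * _]addr0; apply: AL_cons => //; apply: AL_zero. Qed.

Lemma AL_one A L l : subring A -> L l -> AL A L l.
Proof. by move=> sA Ll; rewrite -[l]mul1r; apply: AL_mul1 => //; apply: subring1. Qed.

Lemma AL_add A L f g : AL A L f -> AL A L g -> AL A L (f + g).
Proof.
move=> Af Ag; elim/AL_ind: f / Af => [|a l f Aa Ll _ IH]; first by rewrite add0r.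
by rewrite -addrA; apply: AL_cons.
Qed.

Lemma AL_mono A B L L' f : (forall a, A a -> B a) -> (forall l, L l -> L' l) ->
  AL A L f -> AL B L' f.
Proof.
move=> hA hL; elim/AL_ind => [|a l g Aa Ll _ IH]; first exact: AL_zero.
by apply: AL_cons; [apply: hA | apply: hL|].
Qed.

(** Two coefficient sets appear because [c] may carry one into another: a monomial carries the
    degree-zero ring [B m] into [At], and sets of bounded degree are not subrings. *)
Lemma AL_mul_into A B L c f : (forall a, A a -> B (c * a)) ->
  AL A L f -> AL B L (c * f).
Proof.
move=> h; elim/AL_ind => [|a l g Aa Ll _ IH]; first by rewrite mulr0; apply: AL_zero.
by rewrite mulrDr mulrA; apply: AL_cons => //; apply: h.
Qed.

Lemma AL_mull A L c f : subring A -> A c -> AL A L f -> AL A L (c * f).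
Proof. by move=> sA Ac; apply: (@AL_mul_into A A) => // a Aa; apply: subringM. Qed.

Lemma AL_opp A L f : subring A -> AL A L f -> AL A L (- f).
Proof.
move=> sA h; rewrite -mulN1r; apply: AL_mull => //.
by apply: subringN => //; apply: subring1.
Qed.

Lemma AL_sum A L (J : eqType) (r : seq J) (F : J -> S) :
  (forall j, j \in r -> AL A L (F j)) -> AL A L (\sum_(j <- r) F j).
Proof.
move=> h; rewrite big_seq; apply: big_ind => //; first exact: AL_zero.
by move=> *; apply: AL_add.
Qed.

Lemma AL_sub A L B f : subring B -> (forall a, A a -> B a) -> (forall l, L l -> B l) ->
  AL A L f -> B f.
Proof.
move=> sB hA hL; elim/AL_ind => [|a l g Aa Ll _ IH]; first exact: subring0.
by apply: subringD => //; apply: subringM; [|apply: hA | apply: hL].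
Qed.

Lemma AL_lideal B L A f : lideal B L -> (forall a, A a -> B a) -> AL A L f -> L f.
Proof.
move=> iL hA; elim/AL_ind => [|a l g Aa Ll _ IH]; first exact: (lideal0 iL).
by apply: (lidealD iL) => //; apply: (lidealM iL); first exact: hA.
Qed.

Lemma aut0 A (f : S -> S) : subring A -> ring_aut_on A f -> f 0 = 0.
Proof.
move=> sA [_ [hD _]]; have A0 := subring0 sA.
by have := hD 0 0 A0 A0; rewrite addr0 => e; apply: (addrI (f 0)); rewrite -e addr0.
Qed.
Lemma aut_eq0 A (f : S -> S) a : subring A -> ring_aut_on A f -> A a -> f a = 0 -> a = 0.
Proof.
move=> sA hf Aa e; have [_ [_ [_ [_ [inj _]]]]] := hf.
by apply: inj; rewrite ?(aut0 sA hf) //; apply: subring0.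
Qed.

End Subrings.

(** * Elements annihilated by essential left ideals *)

Section Good.
Variable S : nzRingType.
Variable Rp : S -> Prop.
Hypothesis sR : subring Rp.
Implicit Types (A B L : S -> Prop).

(* For elements of the skew polynomial ring this is membership in Z(R)T, see
   [Zann_lspan] below, but it does not refer to coefficients. *)
Definition Zann (f : S) : Prop :=
  exists2 E, essential_lideal Rp E & forall e, E e -> e * f = 0.

Lemma Zann0 : Zann 0.
Proof. by exists Rp; [apply: essentialT | move=> e _; rewrite mulr0]. Qed.

Lemma ZannD f g : Zann f -> Zann g -> Zann (f + g).
Proof.
move=> [E eE hE] [E' eE' hE']; exists (fun s => E s /\ E' s); first exact: essentialI.
by move=> e [? ?]; rewrite mulrDr hE ?hE' ?addr0.
Qed.

Lemma ZannMr f g : Zann f -> Zann (f * g).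
Proof. by move=> [E eE hE]; exists E => // e Ee; rewrite mulrA hE ?mul0r. Qed.

Lemma ZannN f : Zann f -> Zann (- f).
Proof. by move=> /(@ZannMr _ (-1)); rewrite mulrN1. Qed.

Lemma Zann_sum (J : eqType) (r : seq J) (F : J -> S) :
  (forall j, j \in r -> Zann (F j)) -> Zann (\sum_(j <- r) F j).
Proof.
move=> h; rewrite big_seq; apply: big_ind => //; first exact: Zann0.
by move=> *; apply: ZannD.
Qed.

(** Otherwise the left annihilator of [f] in [R] would be essential. A non-zero [r] whose cyclic
    left ideal meets this annihilator only within the multiples equal to zero is the witness. *)
Lemma notZann_witness f : ~ Zann f ->
  exists r, [/\ Rp r, r <> 0 & forall s, Rp s -> s * r <> 0 -> s * r * f <> 0].
Proof.
move=> nZ; apply: contrapT => H; apply: nZ.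
exists (fun s => Rp s /\ s * f = 0); last by move=> e [].
apply/(essential_elt _ sR); split.
  split=> [s []//|]; split; first by rewrite mul0r; split=> //; apply: subring0.
  split=> [a b [Ra a0] [Rb b0]|a b Ra [Rb b0]].
    by rewrite mulrDl a0 b0 addr0; split=> //; apply: subringD.
  by rewrite -mulrA b0 mulr0; split=> //; apply: subringM.
move=> r Rr r0; apply: contrapT => H'; apply: H; exists r; split=> // s Rs sr0 srf0.
by apply: H'; exists s => //; split=> //; split=> //; apply: subringM.
Qed.

(* [A] need not contain [Rp], so [AL A L] need not lie in [A]: [good_nice] brings
   its elements back into [A]. *)
Record good A : Prop := Good {
  good_subring : subring A;
  good_nice : forall E : seq S, (forall e, e \in E -> AL A Rp e) ->
    exists2 a, A a & forall e, e \in E -> A (a * e) /\ (e <> 0 -> a * e <> 0);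
  good_essential : forall L, essential_lideal Rp L -> forall f, A f -> f <> 0 ->
    exists2 a, A a & a * f <> 0 /\ AL A L (a * f);
  good_uniform : forall L, uniform_lideal Rp L -> forall f g,
    AL A L f -> AL A L g -> f <> 0 -> g <> 0 ->
    exists a b, [/\ A a, A b, a * f = b * g & a * f <> 0] }.

Lemma AL_R L f : lideal Rp L -> AL Rp L f -> L f.
Proof. by move=> iL; apply: (AL_lideal iL). Qed.

Lemma good_R : good Rp.
Proof.
split=> //.
- move=> E hE; exists 1; first exact: subring1.
  by move=> e /hE/(AL_R (lidealT sR)) Re; rewrite mul1r.
- move=> L /(essential_elt _ sR)[iL eL] f Rf f0; have [a Ra [n0 La]] := eL f Rf f0.
  by exists a => //; split=> //; apply: AL_one.
- move=> L /(uniform_elt _ sR)[iL nL uL] f g /(AL_R iL) Lf /(AL_R iL) Lg.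
  exact: uL.
Qed.

(** Zero entries of [E] are filtered out before the nicely essential property is invoked. *)
Lemma nicely_essentialW A B (E : seq S) : nicely_essential A B -> (forall e, e \in E -> B e) ->
  exists2 a, A a & forall e, e \in E -> A (a * e) /\ (e <> 0 -> a * e <> 0).
Proof.
move=> [sA [AB h]] hE.
have [|a [Aa ha]] := h [seq e <- E | e != 0].
  by move=> e; rewrite mem_filter => /andP[/eqP e0 /hE].
exists a => // e eE; have [->|e0] := eqVneq e 0.
  by rewrite mulr0; split=> //; apply: subring0.
by have [|h1 h2] := ha e; rewrite ?mem_filter ?e0.
Qed.

(** [E] collects the left coefficients of one expression of [f]; they are finitely many, so a single
    multiplier can bring all of them into [A]. *)
Lemma AL_nice A B L f : AL B L f -> exists2 E : seq S, (forall e, e \in E -> B e) &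
  forall a, (forall e, e \in E -> A (a * e)) -> AL A L (a * f).
Proof.
elim/AL_ind => [|b l g Bb Ll _ [E hE IH]].
  by exists [::] => // a _; rewrite mulr0; apply: AL_zero.
exists (b :: E) => [e|a ha]; first by rewrite inE => /orP[/eqP->//|/hE].
rewrite mulrDr mulrA; apply: AL_cons => //; first by apply: ha; rewrite mem_head.
by apply: IH => e eE; apply: ha; rewrite inE eE orbT.
Qed.

(** Multipliers found in [B] are moved into [A] by one further [a]. The finite set handed to the
    nicely essential property contains these multipliers, the coefficients of the product in [B L]
    where needed, and the product itself, so that [a] does not kill it. *)
Lemma good_nicely A B : good B -> (forall r, Rp r -> B r) -> nicely_essential A B -> good A.
Proof.
move=> [sB _ eB uB] RB nAB; have [sA [AB _]] := nAB.
split=> //.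
- move=> E hE; apply: (nicely_essentialW nAB) => e /hE; exact: AL_sub.
- move=> L eL f Af f0; have [b Bb [n0 Lbf]] := eB L eL f (AB _ Af) f0.
  have [E hE h] := AL_nice A Lbf.
  have [|a Aa ha] := @nicely_essentialW A B (b :: b * f :: E) nAB.
    move=> e; rewrite !inE => /orP[/eqP->//|/orP[/eqP->|/hE//]].
    by apply: subringM => //; apply: AB.
  have [Aab _] : A (a * b) /\ (b <> 0 -> a * b <> 0) by apply: ha; rewrite mem_head.
  exists (a * b) => //; rewrite -mulrA; split.
    by have [|_] := ha (b * f); [rewrite !inE eqxx orbT | apply].
  by apply: h => e eE; have [|//] := ha e; rewrite !inE eE !orbT.
- move=> L uL f g Lf Lg f0 g0.
  have up h : AL A L h -> AL B L h by apply: AL_mono.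
  have [b [b' [Bb Bb' e n0]]] := uB L uL f g (up _ Lf) (up _ Lg) f0 g0.
  have iL : lideal Rp L by case: uL.
  have [|a Aa ha] := @nicely_essentialW A B [:: b; b'; b * f] nAB.
    move=> x; rewrite !inE => /or3P[] /eqP-> //; apply: subringM => //.
    by apply: (AL_sub sB AB _ Lf) => l /(lidealS iL)/RB.
  have [|Ab _] := ha b; first by rewrite !inE eqxx.
  have [|Ab' _] := ha b'; first by rewrite !inE eqxx orbT.
  have [|_ /(_ n0) n1] := ha (b * f); first by rewrite !inE eqxx !orbT.
  by exists (a * b), (a * b'); split=> //; rewrite -!mulrA ?e -?e.
Qed.

(** * Directed unions of good subrings *)

Section Union.
Variables (T : Type) (P : T -> Prop) (G : T -> S -> Prop) (A : S -> Prop).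
Hypothesis PT : exists i, P i.
Hypothesis Pdir : forall i j, P i -> P j ->
  exists l, [/\ P l, forall s, G i s -> G l s & forall s, G j s -> G l s].
Hypothesis AP : forall f, A f <-> exists2 i, P i & G i f.

Lemma union_sub i s : P i -> G i s -> A s.
Proof. by move=> Pi Gs; apply/AP; exists i. Qed.

Lemma union_AL L f : AL A L f -> exists2 i, P i & AL (G i) L f.
Proof.
elim/AL_ind => [|a l g /AP[i Pi Ga] Ll _ [j Pj Gg]].
  by have [i Pi] := PT; exists i => //; apply: AL_zero.
have [m [Pm im jm]] := Pdir Pi Pj; exists m => //.
by apply: AL_cons; [apply: im | |apply: AL_mono Gg].
Qed.

(** A finite family of monotone conditions, each met in some member of the union, is met in a common
    member. *)
Lemma union_all (J : eqType) (Q : (S -> Prop) -> J -> Prop) (E : seq J) :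
  (forall B C s, (forall t, B t -> C t) -> Q B s -> Q C s) ->
  (forall e, e \in E -> exists2 i, P i & Q (G i) e) ->
  exists2 i, P i & forall e, e \in E -> Q (G i) e.
Proof.
move=> Qm; elim: E => [|e E IH] h; first by have [i Pi] := PT; exists i.
have [|i Pi Gi] := IH; first by move=> s sE; apply: h; rewrite inE sE orbT.
have [|j Pj Gj] := h e; first by rewrite mem_head.
have [m [Pm im jm]] := Pdir Pi Pj; exists m => // s.
by rewrite inE => /orP[/eqP->|/Gi Gs]; [apply: Qm Gj | apply: Qm Gs].
Qed.

Lemma good_union : (forall i, P i -> good (G i)) -> good A.
Proof.
move=> gG; have sA : subring A.
  split; first by have [i Pi] := PT; apply/AP; exists i => //; case: (gG i Pi) => /subring1.
  by split=> a b /AP[i Pi Ga] /AP[j Pj Gb]; have [m [Pm im jm]] := Pdir Pi Pj;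
    have sm := good_subring (gG m Pm); apply/AP; exists m => //;
    [apply: subringB | apply: subringM]; auto.
split=> //.
- move=> E hE; have [||i Pi hi] := @union_all S (fun B s => AL B Rp s) E.
  + by move=> B C s BC; apply: AL_mono.
  + by move=> e /hE/union_AL.
  have [a Aa ha] := good_nice (gG i Pi) hi; exists a; first exact: union_sub Aa.
  by move=> e /ha[h1 h2]; split=> //; apply: union_sub h1.
- move=> L eL f /AP[i Pi Gf] f0; have [a Ga [n0 Lf]] := good_essential (gG i Pi) eL Gf f0.
  exists a; first exact: union_sub Ga.
  by split=> //; apply: AL_mono Lf => // s; apply: union_sub.
- move=> L uL f g Lf Lg f0 g0.
  have [||i Pi hi] := @union_all S (fun B s => AL B L s) [:: f; g].
  + by move=> B C s BC; apply: AL_mono.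
  + by move=> e; rewrite !inE => /orP[]/eqP->; apply: union_AL.
  have [||a [b [Ga Gb e n0]]] := good_uniform (gG i Pi) uL _ _ f0 g0.
  + by apply: hi; rewrite mem_head.
  + by apply: hi; rewrite !inE eqxx orbT.
  by exists a, b; split=> //; [apply: union_sub Ga | apply: union_sub Gb].
Qed.

End Union.

(** Stronger than [notZann_witness]: the multiplier [y] ranges over all of [S], not only over
    [R]. *)
Definition nonsing_rel : Prop := forall f, ~ Zann f ->
  exists r, [/\ Rp r, r <> 0 & forall y, y * r <> 0 -> y * r * f <> 0].

(** * Stability of [Zann] under a good subring and its automorphisms *)

Section Stable.
Hypothesis nsR : nonsing_rel.
Variable A : S -> Prop.
Hypotheses (gA : good A) (RA : forall r, Rp r -> A r).
Let sA : subring A := good_subring gA.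

(** If [p * b] fails [Zann], its witness [r] makes [r * p] non-zero, so some non-zero [a * (r * p)]
    lies in [A E]. That product kills [b], against the choice of [r]. *)
Lemma good_ZannM p b : A p -> A b -> Zann b -> Zann (p * b).
Proof.
move=> Ap Ab [E eE hE]; apply: contrapT => /nsR[r [Rr r0 hr]].
have rp0 : r * p <> 0.
  by move=> e; apply: (hr 1); rewrite mul1r // mulrA e mul0r.
have [a Aa [n0 h]] := good_essential gA eE (subringM sA (RA Rr) Ap) rp0.
apply: (hr a); first by move=> e; apply: n0; rewrite mulrA e mul0r.
rewrite -[a * r * _]mulrA [r * _]mulrA mulrA.
elim/AL_ind: _ / h => [|a' l g Aa' El _ IH]; first by rewrite mul0r.
by rewrite mulrDl IH -mulrA hE ?mulr0 ?addr0.
Qed.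

Lemma Zann_AL E b c : (forall e, E e -> e * b = 0) -> AL A E c -> c * b = 0.
Proof.
move=> hE; elim/AL_ind => [|a' l g Aa' El _ IH]; first by rewrite mul0r.
by rewrite mulrDl IH -mulrA hE ?mulr0 ?addr0.
Qed.

Variable phi : S -> S.
Hypothesis aphi : ring_aut_on A phi.

(** The argument of [good_ZannM], with the witness [r] pulled back along [phi]. *)
Lemma good_Zann_aut b : A b -> Zann b -> Zann (phi b).
Proof.
move=> Ab [E eE hE]; apply: contrapT => /nsR[r [Rr r0 hr]].
have [phiA [_ [phiM [_ [_ surj]]]]] := aphi.
have [r' [Ar' er]] := surj r (RA Rr).
have r'0 : r' <> 0 by move=> e; apply: r0; rewrite -er e (aut0 sA aphi).
have [a Aa [n0 h]] := good_essential gA eE Ar' r'0.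
have Aar := subringM sA Aa Ar'.
apply: (hr (phi a)); rewrite -er -phiM //; first by move/(aut_eq0 sA aphi Aar).
by rewrite -phiM // (Zann_AL hE h) (aut0 sA aphi).
Qed.

(** Here the witness [r] is pushed forward by [phi], and the multiplier found there is pulled
    back. *)
Lemma good_Zann_autV b : A b -> Zann (phi b) -> Zann b.
Proof.
move=> Ab [E eE hE]; apply: contrapT => /nsR[r [Rr r0 hr]].
have [phiA [_ [phiM [_ [_ surj]]]]] := aphi.
have pr0 : phi r <> 0 by move/(aut_eq0 sA aphi (RA Rr)).
have [a Aa [n0 h]] := good_essential gA eE (phiA _ (RA Rr)) pr0.
have [a' [Aa' ea]] := surj a Aa; have Aar := subringM sA Aa' (RA Rr).
apply: (hr a').
  by move=> e; apply: n0; rewrite -ea -phiM ?e ?(aut0 sA aphi) //; apply: RA.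
apply: (aut_eq0 sA aphi); first exact: subringM.
by rewrite !phiM ?ea ?(Zann_AL hE h) //; apply: RA.
Qed.

End Stable.
End Good.

(** * Univariate Ore extensions *)

Record ore (S : nzRingType) (K : S -> Prop) (X : S) (al de : S -> S) : Prop := Ore {
  ore_subring : subring K;
  ore_aut : ring_aut_on K al;
  ore_der : forall p, K p -> K (de p);
  ore_comm : forall p, K p -> X * p = al p * X + de p;
  ore_free : forall n (c : nat -> S), (forall i, K (c i)) ->
    \sum_(i < n) c i * X ^+ i = 0 -> forall i, (i < n)%N -> c i = 0 }.

Section Ore.
Variables (S : nzRingType) (K : S -> Prop) (X : S) (al de : S -> S).
Hypothesis oK : ore K X al de.
Let sK : subring K := ore_subring oK.
Let aal : ring_aut_on K al := ore_aut oK.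

(** The bound is strict: [D n] consists of the polynomials of degree below [n], [D 0] of zero alone.
    A term of degree [n] is therefore the top term of an element of [D n.+1]. *)
Definition D (n : nat) (f : S) : Prop :=
  exists2 c : nat -> S, (forall i, K (c i)) & f = \sum_(i < n) c i * X ^+ i.
Definition KX (f : S) : Prop := exists n, D n f.

(** Coefficients are obtained by choice from this specification; they are meaningful only on [KX],
    where freeness makes them unique. *)
Definition cf_spec (f : S) (c : nat -> S) : Prop := (forall i, K (c i)) /\
  exists2 n, (forall i, (n <= i)%N -> c i = 0) & f = \sum_(i < n) c i * X ^+ i.
Definition cf (f : S) : nat -> S := epsilon (inhabits (fun _ => 0)) (cf_spec f).

Lemma sum_widen (F : nat -> S) m n : (m <= n)%N -> (forall i, (m <= i)%N -> F i = 0) ->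
  \sum_(i < n) F i = \sum_(i < m) F i.
Proof.
move=> mn h; rewrite -[in LHS](subnKC mn) big_split_ord /= [X in _ + X]big1 ?addr0 //.
by move=> i _; rewrite h // leq_addr.
Qed.

Lemma cfP f : KX f -> cf_spec f (cf f).
Proof.
move=> [n [c Kc ->]]; apply: epsilon_spec; exists (fun i => if (i < n)%N then c i else 0).
split; first by move=> i; case: ifP => // _; apply: subring0.
exists n; first by move=> i; rewrite leqNgt; case: ifP.
by apply: eq_bigr => i _; rewrite ltn_ord.
Qed.

Lemma cfK f i : KX f -> K (cf f i).
Proof. by case/cfP => h _; apply: h. Qed.

Lemma spec_KX f c : cf_spec f c -> KX f.
Proof. by move=> [Kc [n _ ->]]; exists n, c. Qed.

Lemma cf_uniq f c : cf_spec f c -> cf f =1 c.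
Proof.
move=> sc; have KXf := spec_KX sc; have [Kg [n gn fg]] := cfP KXf.
have [Kc [m cm fc]] := sc; move=> i; apply/eqP; rewrite -subr_eq0; apply/eqP.
have [iN|iN] := ltnP i (maxn m n); last first.
  by rewrite gn ?cm ?subr0 //; apply: leq_trans iN; rewrite ?leq_maxl ?leq_maxr.
apply: (ore_free oK (n := maxn m n) (c := fun i => cf f i - c i)) => //.
  by move=> j; apply: subringB.
under eq_bigr => j _ do rewrite mulrBl.
rewrite sumrB (@sum_widen (fun i => cf f i * X ^+ i) n) ?leq_maxr //; last first.
  by move=> j /gn->; rewrite mul0r.
rewrite (@sum_widen (fun i => c i * X ^+ i) m) ?leq_maxl //; last first.
  by move=> j /cm->; rewrite mul0r.
by rewrite -fg -fc subrr.
Qed.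

Lemma D_spec n f : D n f <-> KX f /\ forall i, (n <= i)%N -> cf f i = 0.
Proof.
split=> [[c Kc ->]|[/cfP[Kc [m cm fm]] h]].
  set f' := \sum_(_ < _) _.
  have sc : cf_spec f' (fun i => if (i < n)%N then c i else 0).
    split; first by move=> i; case: ifP => // _; apply: subring0.
    exists n; first by move=> i; rewrite leqNgt; case: ifP.
    by apply: eq_bigr => i _; rewrite ltn_ord.
  split; first exact: spec_KX sc.
  by move=> i ni; rewrite (cf_uniq sc) ltnNge ni.
exists (cf f) => //; rewrite [LHS]fm.
rewrite -(@sum_widen (fun i => cf f i * X ^+ i) m (maxn m n)) ?leq_maxl //; last first.
  by move=> j /cm->; rewrite mul0r.
by apply: (@sum_widen (fun i => cf f i * X ^+ i)); rewrite ?leq_maxr // => j /h->; rewrite mul0r.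
Qed.

Lemma D_KX n f : D n f -> KX f. Proof. by exists n. Qed.
Lemma D_cf0 n f i : D n f -> (n <= i)%N -> cf f i = 0.
Proof. by case/D_spec => _ h /h. Qed.

Lemma D_sum n f : D n f -> f = \sum_(i < n) cf f i * X ^+ i.
Proof.
move=> Df; have [KXf h] := (D_spec n f).1 Df.
have [Kc [m cm fm]] := cfP KXf; rewrite [LHS]fm.
rewrite -(@sum_widen (fun i => cf f i * X ^+ i) m (maxn m n)) ?leq_maxl //; last first.
  by move=> j /cm->; rewrite mul0r.
by apply: (@sum_widen (fun i => cf f i * X ^+ i)); rewrite ?leq_maxr // => j /h->; rewrite mul0r.
Qed.

Lemma D0 f : D 0 f -> f = 0.
Proof. by move/D_sum; rewrite big_ord0. Qed.

Lemma D_mono m n f : (m <= n)%N -> D m f -> D n f.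
Proof.
move=> mn Df; apply/D_spec; split; first exact: D_KX Df.
by move=> i ni; apply: D_cf0 Df _; apply: leq_trans ni.
Qed.

Lemma KX_D2 f g : KX f -> KX g -> exists2 n, D n f & D n g.
Proof.
move=> [m Df] [n Degs]; exists (maxn m n); first exact: D_mono (leq_maxl _ _) Df.
exact: D_mono (leq_maxr _ _) Degs.
Qed.

Lemma spec_sumD n f g : D n f -> D n g -> cf_spec (f - g) (fun i => cf f i - cf g i).
Proof.
move=> Df Degs; split; first by move=> i; apply: subringB => //; apply: cfK; [apply: D_KX Df | apply: D_KX Degs].
exists n; first by move=> i ni; rewrite (D_cf0 Df) ?(D_cf0 Degs) ?subr0.
under eq_bigr => j _ do rewrite mulrBl.
by rewrite sumrB -!D_sum.
Qed.

Lemma cfB f g i : KX f -> KX g -> cf (f - g) i = cf f i - cf g i.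
Proof. by move=> Kf Kg; have [n Df Degs] := KX_D2 Kf Kg; rewrite (cf_uniq (spec_sumD Df Degs)). Qed.

Lemma D_B n f g : D n f -> D n g -> D n (f - g).
Proof.
move=> Df Degs; apply/D_spec; split; first exact: spec_KX (spec_sumD Df Degs).
move=> i ni; rewrite cfB; [|exact: D_KX Df|exact: D_KX Degs].
by rewrite (D_cf0 Df) ?(D_cf0 Degs) ?subr0.
Qed.

Lemma D_zero n : D n 0.
Proof. by exists (fun _ => 0) => [i|]; [apply: subring0 | rewrite big1 // => i _; rewrite mul0r]. Qed.
Lemma D_N n f : D n f -> D n (- f).
Proof. by move=> Df; rewrite -sub0r; apply: D_B => //; apply: D_zero. Qed.
Lemma D_D n f g : D n f -> D n g -> D n (f + g).
Proof. by move=> Df Degs; rewrite -[g]opprK; apply: D_B => //; apply: D_N. Qed.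

Lemma cf0 i : cf 0 i = 0.
Proof. by apply: (D_cf0 (D_zero 0)). Qed.

Lemma cfD f g i : KX f -> KX g -> cf (f + g) i = cf f i + cf g i.
Proof.
move=> Kf Kg; have K0 : KX 0 by exists 0%N; apply: D_zero.
have KNg : KX (0 - g) by have [n Degs] := Kg; exists n; apply: D_B => //; apply: D_zero.
by rewrite -[g in LHS]opprK -[- g]sub0r cfB // cfB // cf0 sub0r opprK.
Qed.

Lemma KX_B f g : KX f -> KX g -> KX (f - g).
Proof. by move=> Kf Kg; have [n Df Degs] := KX_D2 Kf Kg; exists n; apply: D_B. Qed.

Lemma cf_eq0 f : KX f -> (forall i, cf f i = 0) -> f = 0.
Proof. by move=> [n /D_sum e] h; rewrite e big1 // => i _; rewrite h mul0r. Qed.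

Lemma KX_deg f : KX f -> f <> 0 -> exists2 n, D n.+1 f & cf f n <> 0.
Proof.
move=> [n]; elim: n => [/D0//|n IH] Df f0.
have [e|e] := eqVneq (cf f n) 0; last by exists n => //; apply/eqP.
apply: IH => //; apply/D_spec; split; first exact: D_KX Df.
by move=> i; rewrite leq_eqVlt => /orP[/eqP<-//|/(D_cf0 Df)].
Qed.

Lemma D_pred n f : D n.+1 f -> cf f n = 0 -> D n f.
Proof.
move=> Df e; apply/D_spec; split; first exact: D_KX Df.
by move=> i; rewrite leq_eqVlt => /orP[/eqP<-//|/(D_cf0 Df)].
Qed.

Lemma spec_mulK n p f : K p -> D n f -> cf_spec (p * f) (fun i => p * cf f i).
Proof.
move=> Kp Df; split; first by move=> i; apply: subringM => //; apply: cfK (D_KX Df).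
exists n; first by move=> i /(D_cf0 Df)->; rewrite mulr0.
by rewrite {1}(D_sum Df) mulr_sumr; apply: eq_bigr => i _; rewrite mulrA.
Qed.
Lemma cf_mulK p f i : K p -> KX f -> cf (p * f) i = p * cf f i.
Proof. by move=> Kp [n Df]; rewrite (cf_uniq (spec_mulK Kp Df)). Qed.
Lemma D_mulK n p f : K p -> D n f -> D n (p * f).
Proof.
move=> Kp Df; apply/D_spec; split; first exact: spec_KX (spec_mulK Kp Df).
by move=> i ni; rewrite cf_mulK ?(D_cf0 Df) ?mulr0 //; apply: D_KX Df.
Qed.

Lemma spec_monom p m : K p -> cf_spec (p * X ^+ m) (fun i => if i == m then p else 0).
Proof.
move=> Kp; split; first by move=> i; case: eqP => // _; apply: subring0.
exists m.+1; first by move=> i; case: eqP => // ->; rewrite ltnn.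
rewrite big_ord_recr /= eqxx big1 ?add0r // => i _.
by rewrite (ltn_eqF (ltn_ord i)) mul0r.
Qed.
Lemma cf_monom p m i : K p -> cf (p * X ^+ m) i = if i == m then p else 0.
Proof. by move=> Kp; rewrite (cf_uniq (spec_monom m Kp)). Qed.
Lemma D_monom p m : K p -> D m.+1 (p * X ^+ m).
Proof.
move=> Kp; apply/D_spec; split; first exact: spec_KX (spec_monom m Kp).
by move=> i; rewrite cf_monom //; case: eqP => // ->; rewrite ltnn.
Qed.
Lemma K_D p : K p -> D 1 p.
Proof. by move=> Kp; have := D_monom 0 Kp; rewrite mulr1. Qed.
Lemma cf_K p i : K p -> cf p i = if i == 0%N then p else 0.
Proof. by move=> Kp; have := cf_monom 0 i Kp; rewrite mulr1. Qed.

(** Turns a drop in degree into an equality of leading coefficients. *)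
Lemma monom_D_eq0 p m : K p -> D m (p * X ^+ m) -> p = 0.
Proof. by move=> Kp /D_cf0 /(_ (leqnn m)); rewrite cf_monom // eqxx. Qed.

Lemma D_top n f : D n.+1 f -> D n (f - cf f n * X ^+ n).
Proof.
move=> Df; have Kc := cfK n (D_KX Df); apply: D_pred.
  by apply: D_B => //; apply: D_monom.
by rewrite cfB ?cf_monom ?eqxx ?subrr //; [apply: D_KX Df | apply: D_KX (D_monom _ Kc)].
Qed.

Lemma alK p m : K p -> K (iter m al p).
Proof. by move=> Kp; elim: m => //= m; case: aal => h _; apply: h. Qed.

Lemma al_iter m : ring_aut_on K (iter m al).
Proof.
elim: m => [|m IH].
  by do !split => //; move=> b Kb; exists b.
have [h1 [h2 [h3 [h4 [h5 h6]]]]] := IH.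
have [a1 [a2 [a3 [a4 [a5 a6]]]]] := aal.
split; first by move=> a Ka /=; apply: a1; apply: h1.
split; first by move=> a b Ka Kb /=; rewrite h2 ?a2 //; apply: h1.
split; first by move=> a b Ka Kb /=; rewrite h3 ?a3 //; apply: h1.
split; first by rewrite /= h4 a4.
split; first by move=> a b Ka Kb /= e; apply: h5 => //; apply: a5 e; apply: h1.
move=> b Kb; have [a [Ka ea]] := a6 b Kb; have [c [Kc ec]] := h6 a Ka.
by exists c; rewrite /= ec.
Qed.

Lemma al_iter0 m : iter m al 0 = 0.
Proof. exact: aut0 sK (al_iter m). Qed.
Lemma al_iterM m p q : K p -> K q -> iter m al (p * q) = iter m al p * iter m al q.
Proof. by have [_ [_ [h _]]] := al_iter m; apply: h. Qed.
Lemma al_iter_eq0 m p : K p -> iter m al p = 0 -> p = 0.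
Proof. exact: aut_eq0 sK (al_iter m). Qed.

Lemma mulX n f : D n.+1 f -> D n.+2 (X * f) /\ cf (X * f) n.+1 = al (cf f n).
Proof.
elim: n f => [|n IH] f Df.
  have Kc := cfK 0 (D_KX Df); have := D_sum Df; rewrite big_ord1 mulr1.
  move: (cf f 0) Kc => p Kp -> {f Df}.
  rewrite (ore_comm oK) //.
  have Da : D 2 (al p * X) by have := D_monom 1 (alK 1 Kp); rewrite expr1.
  have Kd := ore_der oK Kp.
  have Dd : D 2 (- de p) by apply: D_N; apply: D_mono (K_D Kd).
  rewrite -[de _]opprK; split; first exact: D_B.
  rewrite cfB; [|exact: D_KX Da|exact: D_KX Dd].
  have := cf_monom 1 1 (alK 1 Kp); rewrite expr1 /= => ->.
  by rewrite (cf_K _ (subringN sK Kd)) subr0.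
have Kc := cfK n.+1 (D_KX Df); have [Degs _] := IH _ (D_top Df).
have -> : X * f = (al (cf f n.+1) * X ^+ n.+2) -
   - (de (cf f n.+1) * X ^+ n.+1 + X * (f - cf f n.+1 * X ^+ n.+1)).
  have e : X * (cf f n.+1 * X ^+ n.+1) =
      al (cf f n.+1) * X ^+ n.+2 + de (cf f n.+1) * X ^+ n.+1.
    by rewrite mulrA (ore_comm oK) // mulrDl -mulrA -exprS.
  by rewrite mulrBr e opprK addrA [RHS]addrC subrK.
set g := X * (f - _) in Degs *; have Kd := ore_der oK Kc.
have Da := D_monom n.+2 (alK 1 Kc); rewrite /= in Da.
have Dh : D n.+2 (- (de (cf f n.+1) * X ^+ n.+1 + g)).
  by apply: D_N; apply: D_D => //; apply: D_monom.
split; first by apply: D_B => //; apply: D_mono Dh.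
rewrite cfB; [|exact: D_KX Da|exact: D_KX Dh].
have := cf_monom n.+2 n.+2 (alK 1 Kc); rewrite eqxx /= => ->.
by rewrite (D_cf0 Dh) ?subr0.
Qed.

Lemma mulXn m n f : D n.+1 f -> D (m + n).+1 (X ^+ m * f) /\
  cf (X ^+ m * f) (m + n) = iter m al (cf f n).
Proof.
move=> Df; elim: m => [|m [IH1 IH2]]; first by rewrite mul1r.
by have [h1 h2] := mulX IH1; rewrite exprS -mulrA addSn; split=> //=; rewrite h2 IH2.
Qed.

(** After the top term of [f] is split off, only that term reaches degree [m + n]. The resulting
    coefficient may be zero, so the bound need not be the exact degree. *)
Lemma mul_top m n f g : D m.+1 f -> D n.+1 g ->
  D (m + n).+1 (f * g) /\ cf (f * g) (m + n) = cf f m * iter m al (cf g n).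
Proof.
move=> Df Degs; elim: m f Df => [|m IH] f Df.
  have Kc := cfK 0 (D_KX Df); have := D_sum Df; rewrite big_ord1 mulr1 => e.
  rewrite {1 2}e; split; first exact: D_mulK.
  by rewrite cf_mulK //; apply: D_KX Degs.
have Kc := cfK m.+1 (D_KX Df); have [h1 _] := IH _ (D_top Df).
have [x1 x2] := mulXn m.+1 Degs.
have -> : f * g = cf f m.+1 * (X ^+ m.+1 * g) - - ((f - cf f m.+1 * X ^+ m.+1) * g).
  by rewrite opprK mulrBl !mulrA addrC subrK.
set f' := _ - _ in h1 *.
have y1 := D_mulK Kc x1; have h2 : D (m.+1 + n) (- (f' * g)) by exact: D_N.
split; first by apply: D_B => //; apply: D_mono h2.
rewrite cfB; [|exact: D_KX y1|exact: D_KX h2].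
by rewrite (D_cf0 h2) // subr0 cf_mulK // ?x2 //; apply: D_KX x1.
Qed.

Lemma KX_M f g : KX f -> KX g -> KX (f * g).
Proof.
move=> [m Df] [n Degs].
have [h _] := mul_top (D_mono (leqnSn _) Df) (D_mono (leqnSn _) Degs).
exact: D_KX h.
Qed.

Lemma D_mulr n f p : D n f -> K p -> D n (f * p).
Proof.
case: n => [/D0-> _|n Df Kp]; first by rewrite mul0r; apply: D_zero.
by have [h _] := mul_top Df (K_D Kp); rewrite addn0 in h.
Qed.

Lemma subring_KX : subring KX.
Proof.
split; first by exists 1%N; apply: K_D; apply: subring1.
by split=> *; [apply: KX_B | apply: KX_M].
Qed.

Lemma regular_mul_eq0 u f : regular_in K u -> KX f -> u * f = 0 -> f = 0.
Proof.
move=> [Ku reg] Kf e; apply: cf_eq0 => // i.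
by apply: (reg _ (cfK i Kf)).2; rewrite -cf_mulK // e cf0.
Qed.

Lemma regularM u v : regular_in K u -> regular_in K v -> regular_in K (u * v).
Proof.
move=> [Ku ru] [Kv rv]; split; first exact: subringM.
move=> s Ks; split=> e.
  by apply: (ru _ Ks).1; apply: (rv _ (subringM sK Ks Ku)).1; rewrite -mulrA.
by apply: (rv _ Ks).2; apply: (ru _ (subringM sK Kv Ks)).2; rewrite mulrA.
Qed.

Lemma regular1 : regular_in K 1.
Proof. by split; [apply: subring1 | move=> s _; rewrite mulr1 mul1r]. Qed.

(** * Expansions with the coefficients to the right of the powers of [X] *)

Lemma rexp_D n (c : nat -> S) : (forall i, K (c i)) -> D n (\sum_(i < n) X ^+ i * c i).
Proof.
move=> Kc; elim: n => [|n IH]; first by rewrite big_ord0; apply: D_zero.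
rewrite big_ord_recr /=; apply: D_D; first exact: D_mono IH.
by have [h _] := mulXn n (K_D (Kc n)); rewrite addn0 in h.
Qed.

Lemma rexp_top n (c : nat -> S) : (forall i, K (c i)) ->
  cf (\sum_(i < n.+1) X ^+ i * c i) n = iter n al (c n).
Proof.
move=> Kc; rewrite big_ord_recr /=.
have Dn := rexp_D n Kc; have [h1 h2] := mulXn n (K_D (Kc n)); rewrite addn0 in h1 h2.
rewrite cfD; [|exact: D_KX Dn|exact: D_KX h1].
by rewrite (D_cf0 Dn) // add0r h2 cf_K.
Qed.

Lemma rexp_inj n (c : nat -> S) : (forall i, K (c i)) ->
  \sum_(i < n) X ^+ i * c i = 0 -> forall i, (i < n)%N -> c i = 0.
Proof.
move=> Kc; elim: n => [//|n IH] e.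
have cn : c n = 0.
  by apply: (al_iter_eq0 (m := n)) => //; rewrite -rexp_top // e cf0.
move=> i; rewrite ltnS leq_eqVlt => /orP[/eqP->//|]; apply: IH.
by move: e; rewrite big_ord_recr /= cn mulr0 addr0.
Qed.

Lemma rexp_deg n (c : nat -> S) : (forall i, K (c i)) ->
  \sum_(i < n) X ^+ i * c i <> 0 ->
  exists i, [/\ c i <> 0, D i.+1 (\sum_(i < n) X ^+ i * c i) &
    cf (\sum_(i < n) X ^+ i * c i) i = iter i al (c i)].
Proof.
move=> Kc; elim: n => [|n IH]; first by rewrite big_ord0.
have [cn|cn] := eqVneq (c n) 0; first by rewrite big_ord_recr /= cn mulr0 addr0.
move=> _; exists n; split; [exact/eqP|exact: rexp_D|exact: rexp_top].
Qed.

(** As [al] is onto, the top coefficient is the [n]-fold image of some [a], and subtracting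
    [X ^+ n * a] lowers the degree. *)
Lemma rexp_ex n f : D n f -> exists2 c : nat -> S, (forall i, K (c i)) &
  f = \sum_(i < n) X ^+ i * c i.
Proof.
elim: n f => [|n IH] f Df.
  by exists (fun _ => 0) => [i|]; [apply: subring0|rewrite big_ord0 (D0 Df)].
have [_ [_ [_ [_ [_ surj]]]]] := al_iter n.
have [a [Ka ea]] := surj _ (cfK n (D_KX Df)).
have [h1 h2] := mulXn n (K_D Ka); rewrite addn0 in h1 h2.
have [|c Kc ec] := IH (f - X ^+ n * a).
  apply: D_pred; first exact: D_B.
  by rewrite cfB; [rewrite h2 (cf_K 0 Ka) /= ea subrr|exact: D_KX Df|exact: D_KX h1].
exists (fun i => if (i < n)%N then c i else a) => [i|]; first by case: ifP.
rewrite big_ord_recr /= ltnn -(subrK (X ^+ n * a) f) ec; congr (_ + _).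
by apply: eq_bigr => i _; rewrite ltn_ord.
Qed.

(** Elements of [L] multiply right coefficients directly, so those of [f] lie in [K L]. The length
    [N] is left free so that several elements can be expanded to a common length. *)
Lemma rexp_AL L f : AL KX L f -> exists n (c : nat -> S), (forall i, AL K L (c i)) /\
  forall N, (n <= N)%N -> f = \sum_(i < N) X ^+ i * c i.
Proof.
elim/AL_ind => [|a l g [m Da] Ll _ [n [c [Kc ec]]]].
  exists 0%N, (fun _ => 0); split=> [i|N _]; first exact: AL_zero.
  by rewrite big1 // => i _; rewrite mulr0.
have [b Kb eb] := rexp_ex Da; pose b' i := if (i < m)%N then b i else 0.
exists (maxn m n), (fun i => b' i * l + c i); split=> [i|N].
  apply: AL_add => //; rewrite /b'.
  by case: ifP => _; [apply: AL_mul1 | rewrite mul0r; apply: AL_zero].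
rewrite geq_max => /andP[mN nN]; rewrite (ec N nN).
have -> : a = \sum_(i < N) X ^+ i * b' i.
  rewrite (@sum_widen (fun i => X ^+ i * b' i) m) //.
    by rewrite eb; apply: eq_bigr => i _; rewrite /b' ltn_ord.
  by move=> i; rewrite /b' leqNgt => /negPf->; rewrite mulr0.
by rewrite mulr_suml -big_split; apply: eq_bigr => i _; rewrite mulrDr mulrA.
Qed.

(** With [y] expanded with right coefficients [c i], the product [y * r * f] vanishes only if every
    [c i * r * f] does, which forces every [c i * r] to vanish. *)
Lemma nonsing_ext f r : K f -> K r -> (forall y, K y -> y * r <> 0 -> y * r * f <> 0) ->
  forall y, KX y -> y * r <> 0 -> y * r * f <> 0.
Proof.
move=> Kf Kr hr y [n Dy] yr0 yrf0; have [c Kc ey] := rexp_ex Dy.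
apply: yr0; rewrite ey mulr_suml big1 // => i _; rewrite -mulrA.
have [->|/eqP n0] := eqVneq (c i * r) 0; first by rewrite mulr0.
case: (hr _ (Kc i) n0); apply: (rexp_inj (n := n) (c := fun i => c i * r * f)) => //.
  by move=> j; do 2?apply: subringM.
by rewrite -[RHS]yrf0 ey !mulr_suml; apply: eq_bigr => j _; rewrite !mulrA.
Qed.

Section NonsingStep.
Variable Rp : S -> Prop.
Hypotheses (sR : subring Rp) (RK : forall r, Rp r -> K r).

(** The alternative is applied to the top coefficient of [f]. If [s * r] kills it, [f] may be
    replaced by its lower part; otherwise [s * r] is a witness for [f] itself by comparison of
    leading terms. *)
Lemma nonsing_step : (forall f, K f -> forall r, Rp r -> r <> 0 -> exists s,
    [/\ Rp s, s * r <> 0 & s * r * f = 0 \/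
      forall y, K y -> y * (s * r) <> 0 -> y * (s * r) * f <> 0]) ->
  forall f, KX f -> forall r, Rp r -> r <> 0 -> exists s,
    [/\ Rp s, s * r <> 0 & s * r * f = 0 \/
      forall y, KX y -> y * (s * r) <> 0 -> y * (s * r) * f <> 0].
Proof.
move=> HK f [n]; elim: n f => [|n IH] f Df r Rr r0.
  by exists 1; rewrite (D0 Df) mul1r mulr0; split=> //; [apply: subring1|left].
have Kfn := cfK n (D_KX Df).
have [s [Rs sr0 [e|hs]]] := HK _ Kfn r Rr r0.
  have [s' [Rs' s'0 h]] := IH _ (D_top Df) (s * r) (subringM sR Rs Rr) sr0.
  (* Left multiples of [s * r] do not see the top term of [f]. *)
  have ef c : c * (s * r) * (f - cf f n * X ^+ n) = c * (s * r) * f.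
    by rewrite mulrBr [_ * (cf f n * _)]mulrA -[c * _ * _]mulrA e mulr0 mul0r subr0.
  exists (s' * s); rewrite -[s' * s * r]mulrA; split=> //; first exact: subringM.
  case: h => [h|h]; [left; by rewrite -ef|right=> y Ky y0].
  by have := h y Ky y0; rewrite mulrA ef -mulrA.
exists s; split=> //; right=> y [N Dy]; have [c Kc ->] := rexp_ex Dy.
set t := s * r in hs sr0 *; have Kt : K t by apply: RK; apply: subringM.
have -> : (\sum_(i < N) X ^+ i * c i) * t = \sum_(i < N) X ^+ i * (c i * t).
  by rewrite mulr_suml; apply: eq_bigr => i _; rewrite mulrA.
(* At the largest [i] with [c i * t] non-zero, the leading coefficient of the product with [f] is
   the [i]-fold image under [al] of [c i * t * cf f n], which is non-zero by the choice of [s]. *)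
move=> y0; have [|i [ci0 Di ei]] := @rexp_deg N (fun i => c i * t) _ y0.
  by move=> i; apply: subringM.
have [_ top] := mul_top Di Df; rewrite ei -al_iterM // in top; last exact: subringM.
move=> e; have := hs _ (Kc i) ci0; apply.
apply: (al_iter_eq0 (m := i) (subringM sK (subringM sK (Kc i) Kt) Kfn)).
by rewrite -top e cf0.
Qed.

End NonsingStep.

(** The flatness step: in right expansions of a common length, the coefficients at each power of [X]
    sum to zero separately, so the independence over [K] applies power by power. *)
Lemma indep_step (J : eqType) (rs : seq J) (L : J -> S -> Prop) :
  (forall j l, j \in rs -> L j l -> K l) ->
  (forall v, (forall j, j \in rs -> AL K (L j) (v j)) -> \sum_(j <- rs) v j = 0 ->
     forall j, j \in rs -> v j = 0) ->
  forall v, (forall j, j \in rs -> AL KX (L j) (v j)) -> \sum_(j <- rs) v j = 0 ->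
     forall j, j \in rs -> v j = 0.
Proof.
move=> LK IH v hv e.
have /choice[g Hg] : forall j, exists nc : nat * (nat -> S), j \in rs ->
    (forall i, AL K (L j) (nc.2 i)) /\
    forall N, (nc.1 <= N)%N -> v j = \sum_(i < N) X ^+ i * nc.2 i.
  move=> j; have [/hv/rexp_AL[n [c [h1 h2]]]|] := boolP (j \in rs); first by exists (n, c).
  by exists (0%N, fun _ => 0).
pose N := \max_(j <- rs) (g j).1.
have vE j : j \in rs -> v j = \sum_(i < N) X ^+ i * (g j).2 i.
  by move=> jr; apply: (Hg j jr).2; apply: leq_bigmax_seq.
have KL j i : j \in rs -> K ((g j).2 i).
  by move=> jr; apply: (AL_sub sK _ _ ((Hg j jr).1 i)) => // l; apply: LK jr.
have c0 i : (i < N)%N -> forall j, j \in rs -> (g j).2 i = 0.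
  move=> iN; apply: (IH (fun j => (g j).2 i)); first by move=> j /Hg[].
  apply: (rexp_inj (n := N) (c := fun i => \sum_(j <- rs) (g j).2 i)) => //.
    by move=> k; rewrite big_seq; apply: subring_sum => // j; apply: KL.
  rewrite -[RHS]e; under eq_bigr => k _ do rewrite mulr_sumr.
  rewrite exchange_big /= [LHS]big_seq [RHS]big_seq; apply: eq_bigr => j jr.
  by rewrite vE.
by move=> j jr; rewrite vE // big1 // => i _; rewrite c0 ?mulr0.
Qed.

End Ore.

(** * Special subextensions *)

Section ZannOre.
Variables (S : nzRingType) (Rp K : S -> Prop) (X : S) (al de : S -> S).
Hypotheses (sR : subring Rp) (RK : forall r, Rp r -> K r) (oK : ore K X al de).
Let sK : subring K := ore_subring oK.
Local Notation Z := (Zann Rp).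
Local Notation cf := (cf K X).
Local Notation D := (D K X).
Local Notation KX := (KX K X).

Lemma Zann_cf f i : KX f -> Z f -> Z (cf f i).
Proof.
move=> Kf [E eE hE]; exists E => // e Ee.
have Re : Rp e by case: eE => /lidealS h _; apply: h.
by rewrite -(cf_mulK oK) ?hE ?(cf0 oK) //; apply: RK.
Qed.

Lemma Zann_regular b u : K b -> regular_in K u -> Z (b * u) -> Z b.
Proof.
move=> Kb [Ku ru] [E eE hE]; exists E => // e Ee.
have Re : Rp e by case: eE => /lidealS h _; apply: h.
by apply: (ru _ (subringM sK (RK Re) Kb)).1; rewrite -mulrA hE.
Qed.

(** The properties of [Z] over the coefficient ring [K] on which the univariate step rests. The last
    field is the form in which the hypothesis on the derivations enters. *)
Record Zstable : Prop := ZStable {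
  Zst_mul : forall p z, K p -> K z -> Z z -> Z (p * z);
  Zst_al : forall z, K z -> Z z -> Z (al z);
  Zst_alV : forall z, K z -> Z (al z) -> Z z;
  Zst_de : forall z, K z -> Z z -> de z = 0 }.
Hypothesis HZ : Zstable.

Lemma Zann_iter m z : K z -> Z z -> Z (iter m al z).
Proof. by move=> Kz Zz; elim: m => //= m; apply: (Zst_al HZ); apply: (alK oK). Qed.

Lemma Zann_iterV m z : K z -> Z (iter m al z) -> Z z.
Proof.
move=> Kz; elim: m => //= m IH h; apply: IH.
by apply: (Zst_alV HZ) => //; apply: (alK oK).
Qed.

(** All iterates of [z] under [al] stay in [Z], where [de] vanishes, so no lower terms arise. *)
Lemma XnZ m z : K z -> Z z -> X ^+ m * z = iter m al z * X ^+ m.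
Proof.
move=> Kz Zz; elim: m => [|m IH]; first by rewrite mul1r mulr1.
rewrite exprS -mulrA IH mulrA (ore_comm oK); last exact: alK oK _ _ Kz.
rewrite (Zst_de HZ); [by rewrite addr0 -mulrA -exprS|exact: alK oK _ _ Kz|exact: Zann_iter].
Qed.

Lemma monomZ n q j f : D n f -> Z f -> K q ->
  q * X ^+ j * f = \sum_(i < n) q * iter j al (cf f i) * X ^+ (j + i).
Proof.
move=> Df Zf Kq; rewrite {1}(D_sum oK Df) mulr_sumr; apply: eq_bigr => i _.
have Kf := D_KX Df.
by rewrite mulrA -[q * _ * _]mulrA XnZ ?exprD ?mulrA //; [apply: cfK oK _ _ Kf|apply: Zann_cf].
Qed.

Lemma Zann_KXM y f : KX y -> KX f -> Z f -> Z (y * f).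
Proof.
move=> [m Dy] Kf Zf; have [n Df] := Kf; rewrite (D_sum oK Dy) mulr_suml.
apply: Zann_sum => // j _; have Kj := cfK oK j (D_KX Dy).
rewrite (monomZ j Df Zf Kj); apply: Zann_sum => // i _; apply: ZannMr.
have Ki := cfK oK i Kf.
by apply: (Zst_mul HZ) => //; [apply: alK oK _ _ Ki|apply: Zann_iter => //; apply: Zann_cf].
Qed.

(** The top right coefficient [c i] of [z] lies in [K L]; its image under a power of [al] is a left
    coefficient of [z], hence in [Z], and so is [c i]. *)
Lemma singular_descent_step L : lideal Rp L ->
  (forall z, AL K L z -> z <> 0 -> Z z -> exists l, [/\ L l, l <> 0 & Z l]) ->
  forall z, AL KX L z -> z <> 0 -> Z z -> exists l, [/\ L l, l <> 0 & Z l].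
Proof.
move=> iL IH z Lz z0 Zz; have [n [c [Lc /(_ n (leqnn n)) ez]]] := rexp_AL oK Lz.
have Kc i : K (c i) by apply: (AL_sub sK _ _ (Lc i)) => // l /(lidealS iL)/RK.
rewrite ez in z0 Zz; have [i [ci Di ei]] := rexp_deg oK Kc z0.
apply: (IH (c i)) => //; apply: (Zann_iterV (m := i)) => //.
by rewrite -ei; apply: Zann_cf => //; apply: D_KX Di.
Qed.

End ZannOre.

Section SpecialStep.
Variables (S : nzRingType) (Rp K : S -> Prop) (X : S) (al de : S -> S).
Hypotheses (sR : subring Rp) (RK : forall r, Rp r -> K r) (oK : ore K X al de).
Hypothesis HZ : Zstable Rp K al de.
Hypothesis nsR : nonsing_rel Rp.
Let sK : subring K := ore_subring oK.
Local Notation Z := (Zann Rp).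
Local Notation cf := (cf K X).
Local Notation D := (D K X).
Local Notation KX := (KX K X).
Hypothesis sdKX : forall L, lideal Rp L ->
  forall z, AL KX L z -> z <> 0 -> Z z -> exists l, [/\ L l, l <> 0 & Z l].

Variables (At : S -> Prop) (B : nat -> S -> Prop) (up : nat -> S) (phi : nat -> S -> S).

Definition Degs (m : nat) : Prop := exists f, [/\ At f, D m.+1 f & cf f m <> 0].

(* In the paper's notation [up m * X ^+ m] is lambda_m and [phi m] is alpha_(m). *)
Record lam_data (m : nat) : Prop := LamData {
  ld_reg : regular_in K (up m);
  ld_At : At (up m * X ^+ m);
  ld_R : forall r, Rp r -> B m r;
  ld_BAt : forall b, B m b -> At b;
  ld_BK : forall b, B m b -> K b;
  ld_aut : ring_aut_on (B m) (phi m);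
  ld_comm : forall p, B m p -> D m (up m * X ^+ m * p - phi m p * (up m * X ^+ m));
  ld_clear : forall q, K q -> At (q * X ^+ m) -> exists v, [/\ B m v, regular_in K v &
    exists2 b, B m b & v * q * X ^+ m = b * (up m * X ^+ m)] }.

Hypotheses (sAt : subring At) (RAt : forall r, Rp r -> At r)
  (AtKX : forall f, At f -> KX f) (Atgr : forall f i, At f -> At (cf f i * X ^+ i))
  (DegsB : forall m n, Degs m -> Degs n -> (m <= n)%N -> Degs (n - m))
  (ld : forall m, Degs m -> lam_data m)
  (gB : forall m, Degs m -> good Rp (B m)).

Local Notation lam m := (up m * X ^+ m).

Lemma monom_inj p q m : K p -> K q -> p * X ^+ m = q * X ^+ m -> p = q.
Proof.
move=> Kp Kq e; have := cf_monom oK m m Kp; rewrite eqxx => <-.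
by rewrite e (cf_monom oK) // eqxx.
Qed.

Lemma Degs_monom q m : K q -> q <> 0 -> At (q * X ^+ m) -> Degs m.
Proof.
move=> Kq q0 Aq; exists (q * X ^+ m); split=> //; first exact: (D_monom oK).
by rewrite (cf_monom oK) // eqxx.
Qed.

(** The left factor given by [ld_clear] is pulled back along [phi m]: then [v * q * X ^+ m] and
    [lam m * b] agree up to terms of degree below [m]. *)
Lemma ld_norm m q : Degs m -> K q -> At (q * X ^+ m) -> exists v b,
  [/\ B m v, regular_in K v, B m b & v * q = phi m b * up m].
Proof.
move=> Dm Kq Aq; have dm := ld Dm; have [v [Bv rv [b' Bb' e]]] := ld_clear dm Kq Aq.
have [_ [_ [_ [_ [_ surj]]]]] := ld_aut dm; have [b [Bb eb]] := surj _ Bb'.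
exists v, b; split=> //; rewrite eb; have [Kup _] := ld_reg dm.
apply: (monom_inj (m := m)); rewrite ?e ?mulrA //; apply: subringM => //; apply: (ld_BK dm) => //.
Qed.

Lemma AL_At L f : lideal Rp L -> AL At L f -> At f.
Proof. by move=> iL; apply: AL_sub => // l /(lidealS iL)/RAt. Qed.

Lemma AL_B L m b : lideal Rp L -> Degs m -> AL (B m) L b -> B m b.
Proof.
move=> iL Dm; apply: AL_sub => //; first exact: good_subring (gB Dm).
by move=> l /(lidealS iL); apply: (ld_R (ld Dm)).
Qed.

Lemma lam_AL L m b : Degs m -> AL (B m) L b -> AL At L (lam m * b).
Proof.
move=> Dm; apply: (@AL_mul_into _ (B m) At) => // a Ba.
by apply: subringM => //; [apply: (ld_At (ld Dm))|apply: (ld_BAt (ld Dm) Ba)].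
Qed.

(** Induction on the degree bound of [g]: a multiple of [g] is an element of [At L] plus a remainder
    of lower degree. The remainder may vanish, so a separate [h] records what must survive; as no
    non-zero multiple of [h] is in [Z], each stage has an [r] in [R] that protects it. *)
Lemma ess_nonsing L : essential_lideal Rp L -> forall m g h, At g -> D m g -> At h ->
  h <> 0 -> (forall c, At c -> Z (c * h) -> c * h = 0) ->
  exists2 c, At c & c * h <> 0 /\ AL At L (c * g).
Proof.
move=> eL; have iL : lideal Rp L by case: eL.
elim=> [|m IH] g h Ag Dg' Ah h0 hZ.
  exists 1; first exact: subring1.
  by rewrite (D0 oK Dg') mulr0 mul1r; split=> //; apply: AL_zero.
set q := cf g m; have Kq : K q by apply: (cfK oK); apply: AtKX.
have [q0|q0] := eqVneq q 0; first exact: IH (D_pred oK Dg' q0) Ah h0 hZ.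
have Dm : Degs m by exists g; split=> //; apply/eqP.
have dm := ld Dm; have sB := good_subring (gB Dm).
have [v [b [Bv rv Bb evb]]] := ld_norm Dm Kq (Atgr m Ag).
have [phiB [_ [phiM [_ [_ surj]]]]] := ld_aut dm.
have Av := ld_BAt dm Bv; have Kv := ld_BK dm Bv.
have h1 : v * h <> 0 by move/(regular_mul_eq0 oK rv (AtKX Ah)).
have /nsR[r [Rr r0 hr]] : ~ Z (v * h) by move/(hZ _ Av).
(* [r] is pulled back because the multiplier of [g] will be [phi m (a * r') * v], that is
   [phi m a * r * v]. *)
have Br := ld_R dm Rr; have [r' [Br' er]] := surj _ Br.
have r'0 : r' <> 0 by move=> e; apply: r0; rewrite -er e (aut0 sB (ld_aut dm)).
have [a Ba [ar0 La]] : exists2 a, B m a & a * r' <> 0 /\ AL (B m) L (a * r' * b).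
  have [e|/eqP e] := eqVneq (r' * b) 0.
    exists 1; first exact: subring1.
    by rewrite mul1r e; split=> //; apply: AL_zero.
  have [a Ba [n0 La]] := good_essential (gB Dm) eL (subringM sB Br' Bb) e.
  exists a => //; rewrite -mulrA; split=> // e'.
  by apply: n0; rewrite mulrA e' mul0r.
have Bar := subringM sB Ba Br'; have Barb := subringM sB Bar Bb.
(* With this choice [c0 * q] equals [phi m (a * r' * b) * up m], so subtracting [l0] cancels the
   term of degree [m]. *)
set c0 := phi m (a * r') * v.
have Ac0 : At c0 by apply: subringM => //; apply: (ld_BAt dm); apply: phiB.
have ch0 : c0 * h <> 0.
  rewrite -mulrA phiM // er; apply: hr; rewrite -er -phiM // => e.
  exact/ar0/(aut_eq0 sB (ld_aut dm) Bar e).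
set l0 := lam m * (a * r' * b).
have Ll0 : AL At L l0 by apply: lam_AL.
have Ag2 : At (c0 * g - l0).
  by apply: subringB (sAt) _ (AL_At iL Ll0); apply: subringM.
have Dg2 : D m (c0 * g - l0).
  have -> : c0 * g - l0 = c0 * (g - q * X ^+ m) -
      (l0 - phi m (a * r' * b) * lam m).
    have -> : phi m (a * r' * b) * lam m = c0 * (q * X ^+ m).
      by rewrite /c0 [RHS]mulrA -[_ * v * q]mulrA evb [phi m _ * (_ * up m)]mulrA -phiM // [LHS]mulrA.
    by rewrite mulrBr opprB addrA subrK.
  apply: (D_B oK); last exact: (ld_comm dm Barb).
  apply: (D_mulK oK); last exact: (D_top oK).
  by apply: subringM => //; apply: (ld_BK dm); apply: phiB.
have [|c1 Ac1 [n0 Lc1]] := IH _ (c0 * h) Ag2 Dg2 (subringM sAt Ac0 Ah) ch0.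
  by move=> c Ac; rewrite mulrA; apply: hZ; apply: subringM.
exists (c1 * c0); first exact: subringM.
rewrite -[c1 * c0 * h]mulrA -[c1 * c0 * g]mulrA; split=> //; rewrite -[c0 * g](subrK l0) mulrDr.
by apply: AL_add => //; apply: AL_mull.
Qed.

(** Terms of degree at least [n] already lie in [At L]; the next one is treated by a multiplier from
    [K], which acts coefficientwise and so keeps the finished terms in [At L]. The [n]-th
    coefficient stays non-zero, hence so does the product. *)
Lemma ess_sing L : essential_lideal Rp L -> forall n f, At f -> f <> 0 -> Z f ->
  (forall i, (n <= i)%N -> AL At L (cf f i * X ^+ i)) ->
  exists2 c, At c & c * f <> 0 /\ AL At L (c * f).
Proof.
move=> eL; have iL : lideal Rp L by case: eL.
elim=> [|n IH] f Af f0 Zf hf.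
  exists 1; first exact: subring1.
  rewrite mul1r; split=> //; have [m Df] := AtKX Af; rewrite (D_sum oK Df).
  by apply: AL_sum => i _; apply: hf.
set q := cf f n; have Kf := AtKX Af; have Kq : K q by apply: (cfK oK).
have [q0|/eqP q0] := eqVneq q 0.
  apply: IH => // i; rewrite leq_eqVlt => /orP[/eqP<-|/hf//].
  by rewrite -/q q0 mul0r; apply: AL_zero.
have Dn := Degs_monom Kq q0 (Atgr n Af).
have dn := ld Dn; have sB := good_subring (gB Dn).
have [v [b [Bv rv Bb evb]]] := ld_norm Dn Kq (Atgr n Af).
have [phiB [_ [phiM [_ [_ surj]]]]] := ld_aut dn.
have Av := ld_BAt dn Bv; have Kv := ld_BK dn Bv.
have Zq : Z q by apply: (Zann_cf RK oK).
have Zb : Z b.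
  apply: (good_Zann_autV nsR (gB Dn) (ld_R dn) (ld_aut dn)) => //.
  apply: (Zann_regular RK oK _ (ld_reg dn)); first exact/(ld_BK dn)/phiB.
  by rewrite -evb; apply: (Zst_mul HZ).
have b0 : b <> 0.
  move=> e; apply: q0; apply: (rv.2 _ Kq).2.
  by rewrite evb e (aut0 sB (ld_aut dn)) mul0r.
have [a Ba [ab0 La]] := good_essential (gB Dn) eL Bb b0.
have Bab := subringM sB Ba Bb; have Kab := ld_BK dn Bab.
have Zab : Z (a * b) by apply: (good_ZannM nsR (gB Dn) (ld_R dn)).
have [Kup rup] := ld_reg dn; have Kpab := ld_BK dn (phiB _ Bab).
(* Since [a * b] is in [Z], it passes [X ^+ n] without lower terms, and the congruence [ld_comm]
   becomes an equality. *)
have ephi : up n * iter n al (a * b) = phi n (a * b) * up n.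
  apply/eqP; rewrite -subr_eq0; apply/eqP; apply: (monom_D_eq0 oK (m := n)).
    by apply: subringB => //; apply: subringM => //; apply: alK oK _ _ Kab.
  by rewrite mulrBl -!mulrA -(XnZ oK HZ) // [up n * (_ * (a * b))]mulrA; apply: (ld_comm dn Bab).
set c0 := phi n a * v.
have Kpa := ld_BK dn (phiB _ Ba).
have Kc0 : K c0 by apply: subringM.
have Ac0 : At c0 by apply: subringM => //; apply: (ld_BAt dn); apply: phiB.
have ecq : c0 * q = phi n (a * b) * up n by rewrite -mulrA evb mulrA -phiM.
have Kcf := AtKX (subringM sAt Ac0 Af).
have [||||c Ac [n0 Lc]] := IH (c0 * f).
- exact: subringM.
- move=> e; have := congr1 (fun s => cf s n) e; rewrite (cf_mulK oK) // -/q (cf0 oK) ecq.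
  move=> e'; have := (rup _ Kpab).1 e'.
  by move/(aut_eq0 sB (ld_aut dn) Bab).
- by apply: (Zann_KXM sR RK oK HZ) => //; apply: AtKX.
- move=> i; rewrite leq_eqVlt (cf_mulK oK) // => /orP[/eqP<-|/hf h]; last first.
    by rewrite -mulrA; apply: AL_mull.
  rewrite -/q ecq -ephi -mulrA -(XnZ oK HZ) // mulrA.
  exact: lam_AL.
exists (c * c0); first exact: subringM.
by rewrite -mulrA.
Qed.

Lemma At_essential L f : essential_lideal Rp L -> At f -> f <> 0 ->
  exists2 c, At c & c * f <> 0 /\ AL At L (c * f).
Proof.
move=> eL Af f0.
have [[c [Ac n0 Zc]]|H] := pselect (exists c, [/\ At c, c * f <> 0 & Z (c * f)]).
  have Acf := subringM sAt Ac Af; have [n Dn] := AtKX Acf.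
  have [|a Aa [n1 La]] := @ess_sing L eL n _ Acf n0 Zc.
    by move=> i ni; rewrite (D_cf0 oK Dn) // mul0r; apply: AL_zero.
  by exists (a * c); [apply: subringM|rewrite -mulrA].
(* [ess_nonsing] is used with both [g] and [h] equal to [f]. *)
have [n Df] := AtKX Af; apply: ess_nonsing Df _ _ _ => // c Ac Zc.
by apply: contrapT => n0; apply: H; exists c.
Qed.

(** * Normal forms of elements of [At L] *)

Section NormalForm.
Variable L : S -> Prop.
Hypothesis iL : lideal Rp L.

(** The degree bound is on the left factors of the summands, hence also on the sum, as [L] lies in
    [R]. *)
Let ALd d := AL (fun a => At a /\ D d a) L.

(** Induction on the summands. Clearing the degree [d] part of a new left factor requires another
    regular multiplier [v2], which must also act on the part already normalised. *)
Lemma normal_form_step d f : Degs d -> ALd d.+1 f -> exists v b f',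
  [/\ B d v, regular_in K v, AL (B d) L b, ALd d f' & v * f = lam d * b + f'].
Proof.
move=> Dd; have dd := ld Dd; have sB := good_subring (gB Dd).
have [phiB [_ [phiM [_ [_ surj]]]]] := ld_aut dd.
have Alam := ld_At dd.
have low p : B d p -> At (lam d * p - phi d p * lam d) /\ D d (lam d * p - phi d p * lam d).
  move=> Bp; split; last exact: (ld_comm dd Bp).
  by apply: subringB => //; apply: subringM => //; apply: (ld_BAt dd) => //; apply: phiB.
elim/AL_ind => [|a l g [Aa Da] Ll _ [v [b [g' [Bv rv Lb Lg' ev]]]]].
  exists 1, 0, 0; split; [exact: subring1|exact: (regular1 oK)|exact: AL_zero|exact: AL_zero|].
  by rewrite !mulr0 addr0.
have Av := ld_BAt dd Bv; have Kv := ld_BK dd Bv.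
have Ava := subringM sAt Av Aa; have Dva := D_mulK oK Kv Da.
set q := cf (v * a) d; have Kq : K q by apply: (cfK oK); apply: AtKX.
have [v2 [b2 [Bv2 rv2 Bb2 ev2]]] := ld_norm Dd Kq (Atgr d Ava).
(* As [v2 = phi d e], it crosses [lam d] as [e], up to lower terms. *)
have [e [Be ee]] := surj _ Bv2.
have Av2 := ld_BAt dd Bv2; have Kv2 := ld_BK dd Bv2.
(* [low2] is the lower part of the new left factor [v2 * (v * a)] once its top is written as
   [lam d * b2]; [low3] is the error of moving [v2] across [lam d]. *)
set low1 := v2 * (v * a - q * X ^+ d); set low2 := low1 - (lam d * b2 - phi d b2 * lam d).
set low3 := lam d * e - phi d e * lam d.
have hlow2 : At low2 /\ D d low2.
  have [l1 l2] := low _ Bb2; split.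
    by apply: subringB => //; apply: subringM => //; apply: subringB => //; apply: Atgr.
  by apply: (D_B oK) => //; apply: (D_mulK oK) => //; apply: (D_top oK).
exists (v2 * v), (b2 * l + e * b), (low2 * l + (v2 * g' - low3 * b)); split.
- exact: subringM.
- exact: (regularM oK).
- by apply: AL_cons => //; apply: AL_mull.
- apply: AL_cons => //; apply: AL_add.
    apply: (@AL_mul_into _ (fun a => At a /\ D d a) (fun a => At a /\ D d a)) => // s [As Ds].
    by split; [apply: subringM|apply: (D_mulK oK)].
  rewrite -mulNr; apply: (@AL_mul_into _ (B d) (fun a => At a /\ D d a)) => // s Bs.
  have [l1 l2] := low _ Be; rewrite mulNr; split.
    by apply: subringN => //; apply: subringM => //; apply: (ld_BAt dd).
  by apply: (D_N oK); apply: (D_mulr oK) => //; apply: (ld_BK dd).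
have e1 : v2 * (v * a) = lam d * b2 + low2.
  rewrite addrC; apply/eqP; rewrite -subr_eq; apply/eqP.
  rewrite /low2 /low1 mulrBr [v2 * (q * _)]mulrA ev2 -[phi d b2 * _ * _]mulrA.
  by rewrite opprB addrA subrK.
have e2 : v2 * (lam d * b) = lam d * (e * b) - low3 * b.
  by rewrite /low3 mulrBl opprB [_ * (e * b)]mulrA addrC subrK -ee mulrA.
clearbody low2 low3; rewrite mulrDr -mulrA [v * (a * l)]mulrA mulrA e1 -[v2 * v * g]mulrA ev [v2 * (_ + _)]mulrDr e2.
rewrite !mulrDl mulrDr !mulrA -!addrA; congr (_ + _).
rewrite [RHS]addrCA; congr (_ + _); congr (_ + _).
by rewrite addrC.
Qed.

Lemma cf_lam m b : Degs m -> K b -> D m.+1 (lam m * b) /\ cf (lam m * b) m = up m * iter m al b.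
Proof.
move=> Dm Kb; have [Kup _] := ld_reg (ld Dm).
have [h1 h2] := mul_top oK (D_monom oK m Kup) (K_D oK Kb); rewrite addn0 in h1 h2.
by rewrite h2 (cf_monom oK) // eqxx (cf_K oK) // eqxx.
Qed.

Lemma cf_lam_neq0 m b : Degs m -> K b -> b <> 0 -> up m * iter m al b <> 0.
Proof.
move=> Dm Kb b0 e; have [_ rup] := ld_reg (ld Dm).
by apply: b0; apply: (al_iter_eq0 oK Kb) ((rup _ (alK oK m Kb)).2 e).
Qed.

(** If the degree [d] part vanishes, the product [v * f] is still non-zero because [v] is regular,
    and the search continues in lower degree. *)
Lemma normal_form d f : ALd d f -> f <> 0 -> exists n, Degs n /\ exists v b,
  [/\ At v, regular_in K v, AL (B n) L b, b <> 0 & D n (v * f - lam n * b)].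
Proof.
elim: d f => [|d IH] f Lf f0.
  case: f0; elim/AL_ind: f / Lf => [//|a l f [Aa /(D0 oK)->] _ _ ->].
  by rewrite mul0r addr0.
have [Dd|nD] := pselect (Degs d); last first.
  apply: IH f0; apply: AL_mono Lf => // a [Aa Da]; split=> //.
  by apply: (D_pred oK) => //; apply: contrapT => n0; apply: nD; exists a.
have [v [b [f' [Bv rv Lb Lf' e]]]] := normal_form_step Dd Lf.
have Av := ld_BAt (ld Dd) Bv.
have [b0|/eqP b0] := eqVneq b 0.
  have Af : At f by apply: AL_At iL _; apply: AL_mono Lf => // a [].
  have vf0 : v * f <> 0 by move/(regular_mul_eq0 oK rv (AtKX Af)).
  rewrite b0 mulr0 add0r in e; rewrite e in vf0.
  have [n [Dn [w [b' [Aw rw Lb' b'0 Dw]]]]] := IH _ Lf' vf0.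
  exists n; split=> //; exists (w * v), b'; split=> //; first exact: subringM.
    exact: (regularM oK).
  by rewrite -mulrA e.
exists d; split=> //; exists v, b; split=> //.
rewrite e addrC addKr; elim/AL_ind: f' / Lf' {e} => [|a l f' [Aa Da] Ll _ IHf]; first exact: (D_zero oK).
apply: (D_D oK) => //; apply: (D_mulr oK) => //; exact/RK/(lidealS iL).
Qed.

Lemma AL_ALd f : AL At L f -> exists d, ALd d f.
Proof.
elim/AL_ind => [|a l g Aa Ll _ [d Ld]]; first by exists 0%N; apply: AL_zero.
have [n Da] := AtKX Aa; exists (maxn d n); apply: AL_cons => //.
  by split=> //; apply: (D_mono oK) Da; apply: leq_maxr.
apply: AL_mono Ld => // s [As Ds]; split=> //.
by apply: (D_mono oK) Ds; apply: leq_maxl.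
Qed.

(** Regularity of [v] and [up m] keeps both leading coefficients non-zero, so the degree occurring
    in the normal form must be that of [f]. *)
Lemma normal_form_deg f n : AL At L f -> D n.+1 f -> cf f n <> 0 -> exists v b,
  [/\ At v, regular_in K v, AL (B n) L b, b <> 0 & D n (v * f - lam n * b)].
Proof.
move=> Lf Df n0; have [d Ld] := AL_ALd Lf.
have f0 : f <> 0 by move=> e; apply: n0; rewrite e (cf0 oK).
have [m [Dm [v [b [Av rv Lb b0 Dv]]]]] := normal_form Ld f0.
have Kb := ld_BK (ld Dm) (AL_B iL Dm Lb); have [Kv _] := rv.
have KXf := D_KX Df.
have [h1 h2] := cf_lam Dm Kb; have nz := cf_lam_neq0 Dm Kb b0.
have Dvf : D m.+1 (v * f).
  rewrite -(subrK (lam m * b) (v * f)); apply: (D_D oK) => //.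
  by apply: (D_mono oK) Dv.
have evf : v * cf f m = up m * iter m al b.
  rewrite -(cf_mulK oK) // -(subrK (lam m * b) (v * f)) (cfD oK); [|exact: D_KX Dv|exact: D_KX h1].
  by rewrite h2 (D_cf0 oK Dv) // add0r.
have [mn|nm|<-] := ltngtP m n.
- by case: n0; apply: (rv.2 _ (cfK oK n KXf)).2; rewrite -(cf_mulK oK) // (D_cf0 oK Dvf).
- by case: nz; rewrite -evf (D_cf0 oK Df) ?mulr0.
- by exists v, b.
Qed.

End NormalForm.

(** For [f] of degree [m]: a left multiple of [f] by an element of degree zero in [At] again has
    degree [m], or is zero. *)
Definition dconst f m := forall c, At c -> K c -> c * cf f m = 0 -> c * f = 0.

(** A monomial killing the leading term of [f] kills [f]: clearing it by [v] turns its action on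
    every coefficient into that of a single [b] of degree zero, and [dconst] applies to [b]. *)
Lemma homog_kill f m q j : At f -> Z f -> D m.+1 f -> dconst f m -> K q ->
  At (q * X ^+ j) -> q * iter j al (cf f m) = 0 -> q * X ^+ j * f = 0.
Proof.
move=> Af Zf Df cst Kq Aq e; have [->|/eqP q0] := eqVneq q 0; first by rewrite !mul0r.
have Dj := Degs_monom Kq q0 Aq; have dj := ld Dj.
have [v [b [Bv rv Bb evb]]] := ld_norm Dj Kq Aq.
have [phiB [_ [phiM [_ [_ surj]]]]] := ld_aut dj.
have Kf i : K (cf f i) by apply: (cfK oK); apply: AtKX.
have Zcf i : Z (cf f i) by apply: (Zann_cf RK oK) => //; apply: AtKX.
have Kb := ld_BK dj Bb; have Kpb := ld_BK dj (phiB _ Bb).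
have [Kup rup] := ld_reg dj; have Kv := ld_BK dj Bv.
(* Both sides are the degree [j] coefficients of [phi j b * lam j * cf f i] and
   [lam j * b * cf f i], which agree up to lower terms. *)
have key i : v * (q * iter j al (cf f i)) = up j * iter j al (b * cf f i).
  rewrite mulrA evb; apply/esym/eqP; rewrite -subr_eq0; apply/eqP.
  have Kbf := subringM sK Kb (Kf i).
  apply: (monom_D_eq0 oK (m := j)).
    by apply: subringB => //; repeat apply: subringM => //; apply: (alK oK).
  rewrite mulrBl -!mulrA -(XnZ oK HZ) //; last exact: (Zst_mul HZ).
  rewrite -(XnZ oK HZ) //.
  have -> : up j * (X ^+ j * (b * cf f i)) - phi j b * (up j * (X ^+ j * cf f i)) =
     (lam j * b - phi j b * lam j) * cf f i by rewrite mulrBl !mulrA.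
  by apply: (D_mulr oK) => //; apply: (ld_comm dj Bb).
have bf0 : b * f = 0.
  apply: cst => //; first exact: (ld_BAt dj Bb).
  apply: (al_iter_eq0 oK (m := j)); first exact: subringM.
  apply: (rup _ _).2; first by apply: (alK oK); apply: subringM.
  by rewrite -key e mulr0.
rewrite (monomZ RK oK HZ j Df Zf Kq) big1 // => i _.
have -> : q * iter j al (cf f i) = 0; last by rewrite mul0r.
apply: (rv.2 _ _).2; first by apply: subringM => //; apply: (alK oK).
rewrite key -(cf_mulK oK) //; last exact: AtKX.
by rewrite bf0 (cf0 oK) (al_iter0 oK) mulr0.
Qed.

(** Induction on the degree of [y]: its top term kills the leading coefficient of [p], hence all of
    [p] by [homog_kill], so [y] can be shortened. The leading coefficients of [p] and
    [q * X ^+ j * f] agree, so the top term of [y] also kills the latter. *)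
Lemma sing_ann f p m j q : At f -> At p -> Z f -> Z p -> D m.+1 f -> D (j + m).+1 p ->
  dconst f m -> dconst p (j + m) -> K q -> At (q * X ^+ j) ->
  cf p (j + m) = q * iter j al (cf f m) ->
  forall y, At y -> y * p = 0 -> y * (q * X ^+ j * f) = 0.
Proof.
move=> Af Ap Zf Zp Df Dp cstf cstp Kq Aq etop y Ay.
have [d Dy] := AtKX Ay; elim: d y Ay Dy => [|d IH] y Ay Dy yp; first by rewrite (D0 oK Dy) mul0r.
set yd := cf y d; have Kyd : K yd by apply: (cfK oK); apply: AtKX.
have [_ top] := mul_top oK Dy Dp; rewrite yp (cf0 oK) -/yd in top.
have kp := homog_kill Ap Zp Dp cstp Kyd (Atgr d Ay) (esym top).
have Ay' : At (y - yd * X ^+ d) by apply: subringB => //; apply: Atgr.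
have := IH _ Ay' (D_top oK Dy); rewrite mulrBl yp kp subrr => /(_ erefl).
rewrite mulrBl => /eqP; rewrite subr_eq0 => /eqP->.
have Kf := AtKX Af; have Kcf i : K (cf f i) by apply: (cfK oK).
have [_ t2] := mul_top oK (D_monom oK d Kyd) (D_monom oK j Kq).
rewrite !(cf_monom oK) // !eqxx in t2.
(* The product of the two monomials need not be homogeneous; its component of degree [d + j] lies in
   [At] by the grading. *)
have A2 := subringM sAt (Atgr d Ay) Aq; have := Atgr (d + j) A2; rewrite -/yd t2 => A3.
have K3 : K (yd * iter d al q) by apply: subringM => //; apply: (alK oK).
have k3 : yd * iter d al q * X ^+ (d + j) * f = 0.
  apply: (homog_kill Af Zf Df cstf) => //; rewrite iterD -mulrA -(al_iterM oK) //; last exact: (alK oK).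
  by rewrite -etop.
(* On coefficients in [Z] the full product acts as that component, since no derivation
   contributes. *)
rewrite -[RHS]k3 (monomZ RK oK HZ _ Df Zf K3) (monomZ RK oK HZ _ Df Zf Kq) mulr_sumr.
apply: eq_bigr => i _; have Kji := alK oK j (Kcf i).
have Zji : Z (iter j al (cf f i)) by apply: (Zann_iter oK HZ) => //; apply: (Zann_cf RK oK).
rewrite mulrA -[yd * X ^+ d * _]mulrA (XnZ oK HZ); [|exact: subringM|exact: (Zst_mul HZ)].
by rewrite (al_iterM oK) // -iterD -addnA [X ^+ (d + _)]exprD !mulrA.
Qed.

(** * Uniform left ideals in a special subextension *)

Section Uniform.
Variable L : S -> Prop.
Hypothesis uL : uniform_lideal Rp L.
Let iL : lideal Rp L. Proof. by case: uL. Qed.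

(** The induction on the sum of the degrees, for a class [C] that will be [At L] or its part in [Z].
    The two cases differ only in how the inclusion of annihilators, the fourth hypothesis, is
    obtained. *)
Lemma uni_core (C : S -> Prop) :
  (forall f, C f -> AL At L f) -> (forall f g, C f -> C g -> C (f - g)) ->
  (forall a f, At a -> C f -> C (a * f)) ->
  (forall f p m j q, C f -> C p -> p <> 0 -> D m.+1 f -> D (j + m).+1 p ->
     dconst f m -> dconst p (j + m) -> K q -> At (q * X ^+ j) ->
     cf p (j + m) = q * iter j al (cf f m) ->
     exists c, [/\ At c, K c, c * p <> 0 &
        forall y, At y -> y * (c * p) = 0 -> y * (c * (q * X ^+ j * f)) = 0]) ->
  forall N m n f g, (m + n < N)%N -> C f -> C g -> D m.+1 f -> cf f m <> 0 ->
    D n.+1 g -> cf g n <> 0 -> exists a b, [/\ At a, At b, a * f = b * g & a * f <> 0].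
Proof.
move=> CL CB CM Hann; elim=> [//|N IH] m n f g.
wlog mn : m n f g / (m <= n)%N.
  move=> W mnN Cf Cg Df f0 Dg' g0; have [mn|nm] := leqP m n; first exact: W Df f0 Dg' g0.
  have [|a [b [Aa Ab e n0]]] := W n m g f (ltnW nm) _ Cg Cf Dg' g0 Df f0; first by rewrite addnC.
  by exists b, a; rewrite -e.
move=> mnN Cf Cg Df f0 Dg' g0.
have CA h : C h -> At h by move/CL; apply: AL_At.
(* When [dconst] fails, a degree-zero multiplier cancels the leading coefficient without killing
   [h], and the induction hypothesis applies to the multiple. *)
have lower h k : C h -> D k.+1 h -> ~ dconst h k ->
    exists c k', [/\ At c, (k' < k)%N, D k'.+1 (c * h) & cf (c * h) k' <> 0].
  move=> Ch Dh nc; have [c Hc] : exists c, ~ (At c -> K c -> c * cf h k = 0 -> c * h = 0).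
    by apply/existsNP.
  move/not_implyP: Hc => [Ac /not_implyP[Kc /not_implyP[e n0]]].
  have Kch := AtKX (subringM sAt Ac (CA _ Ch)).
  have [k' Dk' k'0] := KX_deg oK Kch n0; exists c, k'; split=> //.
  rewrite ltnNge; apply/negP => kk'; apply: k'0; apply: (D_cf0 oK) kk'.
  by apply: (D_pred oK (D_mulK oK Kc Dh)); rewrite (cf_mulK oK) //; apply/AtKX/CA.
have [cstf|/(lower _ _ Cf Df)[c [k [Ac km Dk k0]]]] := pselect (dconst f m); last first.
  have [|a [b [Aa Ab e n0]]] := IH k n (c * f) g _ (CM _ _ Ac Cf) Cg Dk k0 Dg' g0.
    by rewrite ltnS in mnN; apply: leq_trans mnN; rewrite ltn_add2r.
  by exists (a * c), b; rewrite -mulrA; split=> //; apply: subringM.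
have [cstg|/(lower _ _ Cg Dg')[c [k [Ac kn Dk k0]]]] := pselect (dconst g n); last first.
  have [|a [b [Aa Ab e n0]]] := IH m k f (c * g) _ Cf (CM _ _ Ac Cg) Df f0 Dk k0.
    by rewrite ltnS in mnN; apply: leq_trans mnN; rewrite ltn_add2l.
  by exists a, (b * c); rewrite -mulrA; split=> //; apply: subringM.
have Kf := AtKX (CA _ Cf); have Kg := AtKX (CA _ Cg).
have Degs_m : Degs m by exists f; split=> //; apply: CA.
have Degs_n : Degs n by exists g; split=> //; apply: CA.
set j := (n - m)%N; have Degs_j : Degs j := DegsB Degs_m Degs_n mn; have jm : (j + m)%N = n by rewrite subnK.
have dn := ld Degs_n; have dj := ld Degs_j; have sB := good_subring (gB Degs_n).
have [phiB [_ [phiM [_ [_ surj]]]]] := ld_aut dn.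
have [Kuj ruj] := ld_reg dj.
have Cf1 : C (lam j * f) := CM _ _ (ld_At dj) Cf.
have [Df1 tf1] := mul_top oK (D_monom oK j Kuj) Df; rewrite jm in Df1 tf1.
rewrite (cf_monom oK) // eqxx in tf1.
have f10 : cf (lam j * f) n <> 0.
  rewrite tf1 => e; apply: f0; have Kc := cfK oK m Kf.
  exact: (al_iter_eq0 oK Kc) ((ruj _ (alK oK j Kc)).2 e).
have [v1 [b1 [Av1 [Kv1 rv1] Lb1 b10 Dv1]]] := normal_form_deg iL (CL _ Cf1) Df1 f10.
have [v2 [b2 [Av2 [Kv2 rv2] Lb2 b20 Dv2]]] := normal_form_deg iL (CL _ Cg) Dg' g0.
(* After [lam j] has made the degrees equal, uniformity over [B n] gives the two normal forms a
   common leading part. *)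
have [e1 [e2 [Be1 Be2 ee ne]]] := good_uniform (gB Degs_n) uL Lb1 Lb2 b10 b20.
have Bb1 := AL_B iL Degs_n Lb1; have Bb2 := AL_B iL Degs_n Lb2.
have red e b v h : B n e -> B n b -> D n (v * h - lam n * b) ->
    D n (phi n e * v * h - lam n * (e * b)).
  move=> Be Bb Dv; have -> : phi n e * v * h - lam n * (e * b) =
     phi n e * (v * h - lam n * b) - (lam n * e - phi n e * lam n) * b.
    rewrite mulrBr mulrBl opprB addrA !mulrA; congr (_ - _).
    by rewrite subrK.
  apply: (D_B oK); first by apply: (D_mulK oK) => //; apply/(ld_BK dn)/phiB.
  by apply: (D_mulr oK); [apply: (ld_comm dn Be)|apply: (ld_BK dn)].
have r1 := red _ _ _ _ Be1 Bb1 Dv1; have r2 := red _ _ _ _ Be2 Bb2 Dv2.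
set w := phi n e1 * v1 in r1; set e := phi n e2 * v2 in r2.
have Aw : At w by apply: subringM => //; apply/(ld_BAt dn)/phiB.
have Ae : At e by apply: subringM => //; apply/(ld_BAt dn)/phiB.
have Kw : K w by apply: subringM => //; apply/(ld_BK dn)/phiB.
have Ke : K e by apply: subringM => //; apply/(ld_BK dn)/phiB.
set p := e * g; have Cp : C p by apply: CM.
set q := w * up j; have Kq : K q by apply: subringM.
have eqX : q * X ^+ j * f = w * (lam j * f) by rewrite !mulrA.
have Aq : At (q * X ^+ j) by rewrite -mulrA; apply: subringM => //; apply: (ld_At dj).
have Dp : D n.+1 p by apply: (D_mulK oK).
have Dw : D n.+1 (w * (lam j * f)) by apply: (D_mulK oK).
have Dh : D n (p - w * (lam j * f)).
  have -> : p - w * (lam j * f) = (p - lam n * (e2 * b2)) - (w * (lam j * f) - lam n * (e1 * b1)).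
    by rewrite ee opprB addrA subrK.
  exact: (D_B oK).
have etop : cf p n = q * iter j al (cf f m).
  apply/eqP; rewrite -mulrA -tf1 -(cf_mulK oK) //; last exact: D_KX Df1.
  by rewrite -subr_eq0 -(cfB oK) ?(D_cf0 oK Dh) //; [apply: D_KX Dp|apply: D_KX Dw].
have p0n : cf p n <> 0.
  have Bbb := subringM sB Be2 Bb2; have Kbb := ld_BK dn Bbb.
  have [h1 h2] := cf_lam Degs_n Kbb.
  rewrite -(subrK (lam n * (e2 * b2)) p) (cfD oK); [|exact: D_KX r2|exact: D_KX h1].
  by rewrite (D_cf0 oK r2) // add0r h2; apply: cf_lam_neq0 => //; rewrite -ee.
have p0 : p <> 0 by move=> E; apply: p0n; rewrite E (cf0 oK).
have cstp : dconst p (j + m).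
  rewrite jm => c Ac Kc E; rewrite mulrA; apply: cstg; [exact: subringM|exact: subringM|].
  by rewrite -mulrA -(cf_mulK oK).
rewrite -jm in Dp etop.
have [c [Ac Kc cp0 Hc]] := Hann f p m j q Cf Cp p0 Df Dp cstf cstp Kq Aq etop.
rewrite eqX in Hc; set h := c * p - c * (w * (lam j * f)).
have Dch : D n h by rewrite /h -mulrBr; apply: (D_mulK oK).
have Ch : C h := CB _ _ (CM _ _ Ac Cp) (CM _ _ Ac (CM _ _ Aw Cf1)).
have [/eqP h0|/eqP h0] := eqVneq h 0.
  rewrite subr_eq0 in h0; move/eqP: h0 => h0.
  exists (c * w * lam j), (c * e); split.
  - exact: (subringM sAt (subringM sAt Ac Aw) (ld_At dj)).
  - exact: subringM.
  - by rewrite -[RHS]mulrA h0 -[LHS]mulrA -[LHS]mulrA.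
  - by rewrite -[c * w * _ * _]mulrA -[c * w * _]mulrA -h0.
have [k Dk k0] := KX_deg oK (AtKX (CA _ Ch)) h0.
have kn : (k < n)%N.
  by rewrite ltnNge; apply/negP => nk; apply: k0; apply: (D_cf0 oK) nk.
(* [h] has degree below [n], so [f] and [h] have a common multiple. Moving the part of [h] that is a
   multiple of [f] to the other side leaves a multiple of [g]. *)
have [|a [b [Aa Ab eab nab]]] := IH m k f h _ Cf Ch Df f0 Dk k0.
  by rewrite ltnS in mnN; apply: leq_trans mnN; rewrite ltn_add2l.
(* If the multiple of [g] vanished, the inclusion of annihilators would kill the other part of
   [b * h] as well, contradicting [nab]. *)
have [bcp|/eqP bcp] := eqVneq (b * (c * p)) 0.
  by case: nab; rewrite eab mulrBr bcp (Hc b) ?subrr.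
have eE : b * (c * (w * (lam j * f))) = b * c * w * lam j * f.
  by rewrite -[RHS]mulrA -[RHS]mulrA -[RHS]mulrA.
exists (a + b * c * w * lam j), (b * c * e); split.
- exact: (subringD sAt Aa (subringM sAt (subringM sAt (subringM sAt Ab Ac) Aw) (ld_At dj))).
- exact: (subringM sAt (subringM sAt Ab Ac) Ae).
- by rewrite mulrDl -eE eab mulrBr subrK -[RHS]mulrA -[RHS]mulrA.
- by rewrite mulrDl -eE eab mulrBr subrK.
Qed.

(** The element of [Z] descends to some non-zero [l] in [L]; uniformity of [L] then makes [r * s]
    lie in [Z] for essentially many [r], for every [s] in [L]. Were [f] without non-zero multiples
    in [Z], [ess_nonsing] would push its summands into [Z] while preserving [f]. *)
Lemma sing_multiple : (exists z, [/\ AL At L z, z <> 0 & Z z]) ->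
  forall f, AL At L f -> f <> 0 -> exists c, [/\ At c, c * f <> 0 & Z (c * f)].
Proof.
move=> [z [Lz z0 Zz]].
have [l [Ll l0 Zl]] := sdKX iL (AL_mono AtKX (fun s h => h) Lz) z0 Zz.
move=> f Lf f0; apply: contrapT => H; have Af := AL_At iL Lf.
have hf c : At c -> Z (c * f) -> c * f = 0.
  by move=> Ac Zc; apply: contrapT => n0; apply: H; exists c.
have ZR r s : Rp r -> Rp s -> Z s -> Z (r * s).
  by move=> Rr Rs; apply: (Zst_mul HZ); apply: RK.
have eJ s : L s -> essential_lideal Rp (fun r => Rp r /\ Z (r * s)).
  move=> Ls; apply/(essential_elt _ sR); split.
    split=> [r []//|]; split; first by rewrite mul0r; split; [apply: subring0|apply: Zann0].
    split=> [a b [Ra Za] [Rb Zb]|a b Ra [Rb Zb]].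
      by rewrite mulrDl; split; [apply: subringD|apply: ZannD].
    rewrite -mulrA; split; first exact: subringM.
    by apply: ZR => //; apply: subringM => //; apply: lidealS iL Ls.
  move=> r Rr r0; have [rs|/eqP rs] := eqVneq (r * s) 0.
    exists 1; first exact: subring1.
    by rewrite mul1r rs; split=> //; split=> //; apply: Zann0.
  have [_ _ uL'] := (uniform_elt L sR).1 uL.
  have [a [b [Ra Rb e n0]]] := uL' _ _ (lidealM iL Rr Ls) Ll rs l0.
  exists a => //; split; first by move=> E; apply: n0; rewrite mulrA E mul0r.
  split; first exact: subringM.
  by rewrite -mulrA e; apply: ZR => //; apply: lidealS iL Ll.
have [c [Ac n0 Zc]] : exists c, [/\ At c, c * f <> 0 & Z (c * f)]; last by case: n0; apply: hf.
(* The element moved into [Z] is separated from the one to be preserved, so that induction over the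
   summands of [g] is possible; finally [g] is [f]. *)
have : forall g, AL At L g -> exists c, [/\ At c, c * f <> 0 & Z (c * g)]; last by apply.
move=> g; elim/AL_ind => [|a s g' Aa Ls Lg' [c [Ac n0 Zc]]].
  by exists 1; rewrite mulr0 mul1r; split=> //; [apply: subring1|apply: Zann0].
have Aca := subringM sAt Ac Aa; have [d Dca] := AtKX Aca.
have [|c' Ac' [n1 Lc']] := ess_nonsing (eJ _ Ls) Aca Dca (subringM sAt Ac Af) n0.
  by move=> x Ax; rewrite mulrA; apply: hf; apply: subringM.
exists (c' * c); split; [exact: subringM|by rewrite -mulrA|].
rewrite mulrDr -!mulrA; apply: ZannD => //; last first.
  apply: (Zann_KXM sR RK oK HZ) => //; first exact: AtKX.
  exact: AtKX (subringM sAt Ac (AL_At iL Lg')).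
rewrite [c * _]mulrA mulrA; elim/AL_ind: _ / Lc' => [|x r y Ax [Rr Zr] _ IHy].
  by rewrite mul0r; apply: Zann0.
rewrite mulrDl -mulrA; apply: ZannD => //; apply: (Zann_KXM sR RK oK HZ) => //; first exact: AtKX.
exact: AtKX (RAt (subringM sR Rr (lidealS iL Ls))).
Qed.

Lemma At_uniform f g : AL At L f -> AL At L g -> f <> 0 -> g <> 0 ->
  exists a b, [/\ At a, At b, a * f = b * g & a * f <> 0].
Proof.
move=> Lf Lg f0 g0.
have [Hz|Hz] := pselect (exists z, [/\ AL At L z, z <> 0 & Z z]).
  have [c [Ac cf0 Zc]] := sing_multiple Hz Lf f0.
  have [c' [Ac' cg0 Zc']] := sing_multiple Hz Lg g0.
  have [m Dm m0] := KX_deg oK (AtKX (subringM sAt Ac (AL_At iL Lf))) cf0.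
  have [n Dn n0] := KX_deg oK (AtKX (subringM sAt Ac' (AL_At iL Lg))) cg0.
  (* Both elements have been replaced by multiples in [Z], where [sing_ann] gives the inclusion of
     annihilators with [c = 1]. *)
  have [||||||a [b [Aa Ab e nz]]] := @uni_core (fun h => AL At L h /\ Z h) _ _ _ _
      (m + n).+1 m n (c * f) (c' * g) (ltnSn _) _ _ Dm m0 Dn n0.
  - by move=> h [].
  - move=> h h' [Lh Zh] [Lh' Zh']; split; first by apply: AL_add => //; apply: AL_opp.
    by apply: ZannD => //; apply: ZannN.
  - move=> a h Aa [Lh Zh]; split; first exact: AL_mull.
    by apply: (Zann_KXM sR RK oK HZ) => //; apply: AtKX => //; apply: (AL_At iL).
  - move=> h p k j q [Lh Zh] [Lp Zp] p0 Dh Dp ch cp Kq Aq etop.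
    exists 1; rewrite !mul1r; split=> //; [exact: subring1|exact: subring1|].
    by apply: sing_ann Dh Dp ch cp Kq Aq etop => //; apply: (AL_At iL).
  - by split=> //; apply: AL_mull.
  - by split=> //; apply: AL_mull.
  by exists (a * c), (b * c'); rewrite -!mulrA; split=> //; apply: subringM.
have [m Dm m0] := KX_deg oK (AtKX (AL_At iL Lf)) f0.
have [n Dn n0] := KX_deg oK (AtKX (AL_At iL Lg)) g0.
apply: (@uni_core (AL At L) _ _ _ _ (m + n).+1 m n f g (ltnSn _) Lf Lg Dm m0 Dn n0) => //.
- by move=> h h' Lh Lh'; apply: AL_add => //; apply: AL_opp.
- by move=> a h Aa Lh; apply: AL_mull.
- move=> h p k j q Lh Lp p0 Dh Dp ch cp Kq Aq etop.
  (* Now no non-zero element of [At L] is in [Z]. With [c = r], any [y] killing [r * p] satisfies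
     [y * r = 0] and so kills every right multiple of [r]. *)
  have /nsR[r [Rr r0 hr]] : ~ Z p by move=> Zp; apply: Hz; exists p.
  exists r; split; [exact: RAt|exact: RK| |].
    by move=> E; apply: (hr 1); rewrite mul1r.
  move=> y Ay E; have [yr|/eqP yr] := eqVneq (y * r) 0; first by rewrite mulrA yr mul0r.
  by case: (hr y yr); rewrite -mulrA.
Qed.

End Uniform.

Lemma good_At : good Rp At.
Proof.
split=> //.
- move=> E hE; exists 1; first exact: subring1.
  by move=> e /hE/(AL_sub sAt (fun s h => h) RAt) Ae; rewrite mul1r.
- by move=> L eL f; apply: At_essential.
- by move=> L uL f g; apply: At_uniform.
Qed.

End SpecialStep.

(** * Iterated Ore extensions *)

Section Lspan.
Variables (S : nzRingType) (d : Order.disp_t) (I : orderType d) (x : I -> S).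
Implicit Types (C : S -> Prop) (P : I -> bool).

Lemma lspan_zero C P : lspan x C P 0.
Proof. by exists [::], [::]; rewrite big_nil. Qed.

Lemma lspan_cons C P r t f : C r -> std P t -> lspan x C P f ->
  lspan x C P (r * term x t + f).
Proof.
move=> Cr st [ts [rs [sz [hts [hrs ->]]]]]; exists (t :: ts), (r :: rs).
split; first by rewrite /= sz.
split; first by move=> u; rewrite inE => /orP[/eqP->//|/hts].
split; first by move=> u; rewrite inE => /orP[/eqP->//|/hrs].
by rewrite /= big_cons.
Qed.

Lemma lspan_ind C P (Q : S -> Prop) : Q 0 ->
  (forall r t f, C r -> std P t -> lspan x C P f -> Q f -> Q (r * term x t + f)) ->
  forall f, lspan x C P f -> Q f.
Proof.
move=> Q0 Qc f [ts [rs [sz [hts [hrs ->]]]]].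
elim: rs ts sz hts hrs => [|r rs IH] [|t ts] //= sz hts hrs; first by rewrite big_nil.
have hts' u : u \in ts -> std P u by move=> hu; apply: hts; rewrite inE hu orbT.
have hrs' u : u \in rs -> C u by move=> hu; apply: hrs; rewrite inE hu orbT.
have sz' : size rs = size ts by case: sz.
rewrite big_cons; apply: Qc; [by apply: hrs; rewrite mem_head|
  by apply: hts; rewrite mem_head| |exact: IH].
by exists ts, rs.
Qed.

Lemma lspan_add C P f g : lspan x C P f -> lspan x C P g -> lspan x C P (f + g).
Proof.
move=> hf hg; elim/lspan_ind: f / hf => [|r t f Cr st _ IH]; first by rewrite add0r.
by rewrite -addrA; apply: lspan_cons.
Qed.

Lemma std_mono P P' t : (forall s, P s -> P' s) -> std P t -> std P' t.
Proof. by move=> h /andP[s1 s2]; apply/andP; split=> //; apply: sub_all s2. Qed.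

Lemma lspan_mono C C' P P' f : (forall r, C r -> C' r) -> (forall s, P s -> P' s) ->
  lspan x C P f -> lspan x C' P' f.
Proof.
move=> hC hP; elim/lspan_ind => [|r t g Cr st _ IH]; first exact: lspan_zero.
by apply: lspan_cons => //; [apply: hC|apply: std_mono st].
Qed.

Lemma lspan_const C P r : C r -> lspan x C P r.
Proof.
move=> Cr; have := lspan_cons (t := [::]) Cr (erefl : std P [::]) (lspan_zero C P).
by rewrite /term big_nil mulr1 addr0.
Qed.

(** The lists in [lspan] may repeat a term; repetitions are merged so that freeness over distinct
    terms can be applied. *)
Lemma lspan_normal C P f : C 0 -> (forall r s, C r -> C s -> C (r + s)) -> lspan x C P f ->
  exists (ts : seq (seq I)) (c : seq I -> S), [/\ uniq ts, forall t, t \in ts -> std P t,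
    forall t, C (c t) & f = \sum_(t <- ts) c t * term x t].
Proof.
move=> C0 CD hf.
(* Vanishing of [c] outside [ts] is added so that a new term starts from coefficient zero. *)
suff [ts [c [u st Cc h0 e]]] : exists (ts : seq (seq I)) (c : seq I -> S),
   [/\ uniq ts, forall t, t \in ts -> std P t, forall t, C (c t),
     forall t, t \notin ts -> c t = 0 & f = \sum_(t <- ts) c t * term x t] by exists ts, c.
elim/lspan_ind: f / hf => [|r t f Cr st _ [ts [c [u hts Cc h0 e]]]].
  by exists [::], (fun _ => 0); rewrite big_nil.
pose c' s := c s + (if s == t then r else 0).
have Cc' s : C (c' s) by apply: CD => //; case: ifP.
have [tin|tnin] := boolP (t \in ts).
  exists ts, c'; split=> //.
    move=> s sn; rewrite /c' h0 // add0r; case: eqP => // es.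
    by rewrite es tin in sn.
  under eq_bigr => s _ do rewrite mulrDl.
  rewrite big_split /= -e addrC; congr (_ + _).
  rewrite (bigD1_seq t) //= eqxx big1 ?addr0 // => s /negPf->.
  by rewrite mul0r.
exists (t :: ts), c'; split=> //=.
- by rewrite tnin.
- by move=> s; rewrite inE => /orP[/eqP->//|/hts].
- move=> s; rewrite inE negb_or => /andP[/negPf st' sn].
  by rewrite /c' h0 // st' addr0.
rewrite big_cons /c' h0 // eqxx add0r e; congr (_ + _).
apply: eq_big_seq => s sin; case: eqP => [es|_]; last by rewrite addr0.
by rewrite -es sin in tnin.
Qed.

End Lspan.

Section Multi.
Variables (S : nzRingType) (d : Order.disp_t) (I : orderType d)
  (Rp : S -> Prop) (x : I -> S) (alpha delta : I -> S -> S).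
Hypothesis sp : skew_poly_bijective Rp x alpha delta.
Hypothesis Hd : forall (k : I) (f : S),
  lspan x (Zsing Rp) (fun s => (s < k)%O) f -> delta k f = 0.

Let sR : subring Rp. Proof. by case: sp => _ []. Qed.
Let Sk k := Sk Rp x k.
Let Sk1 k := Sk1 Rp x k.

Lemma Sk_ore k : ore (Sk k) (x k) (alpha k) (delta k).
Proof.
have [_ [_ [_ [_ [sub /(_ k)]]]]] := sp.
move=> [aut [dK [_ [_ [comm [_ free]]]]]].
split=> //; first exact: (sub (Some k)).
move=> n c Kc e i iN.
apply: (free (mkseq c n)).
- move=> p /mapP[j _ ->]; exact: Kc.
- rewrite /xpoly size_mkseq -[RHS]e; apply: eq_bigr => j _.
  by rewrite nth_mkseq.
- by apply/mapP; exists i => //; rewrite mem_iota.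
Qed.

Lemma Rp_Sk k r : Rp r -> Sk k r. Proof. exact: lspan_const. Qed.

Lemma xpoly_spec k ps : (forall p, p \in ps -> Sk k p) ->
  cf_spec (Sk k) (x k) (xpoly x k ps) (nth 0 ps).
Proof.
move=> h; split.
  move=> i; have [iN|iN] := ltnP i (size ps); first by apply: h; apply: mem_nth.
  by rewrite nth_default //; apply: lspan_zero.
by exists (size ps) => // i iN; rewrite nth_default.
Qed.

Lemma Sk1_KX k f : Sk1 k f <-> KX (Sk k) (x k) f.
Proof.
split.
  have [_ [_ [_ [_ [_ /(_ k)]]]]] := sp.
  move=> [_ [_ [_ [_ [_ [h _]]]]]] /h[ps [hps ->]].
  exact: spec_KX (xpoly_spec hps).
move=> [n [c Kc ->]]; rewrite -(big_mkord xpredT (fun i => c i * x k ^+ i)).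
apply: big_ind => [|f1 f2|i _]; [exact: lspan_zero|exact: lspan_add|].
elim/lspan_ind: _ / (Kc i) => [|r t g Rr st _ IH]; first by rewrite mul0r; apply: lspan_zero.
rewrite mulrDl; apply: lspan_add IH.
have -> : r * term x t * x k ^+ i = r * term x (t ++ nseq i k) + 0.
  by rewrite addr0 /term big_cat /= mulrA big_nseq -Monoid.iteropE.
apply: lspan_cons => //; last exact: lspan_zero.
have /andP[s1 s2] := st; apply/andP; split.
  have tr : transitive (fun a b : I => (a <= b)%O) by move=> ? ? ?; apply: le_trans.
  rewrite sorted_pairwise // pairwise_cat -!sorted_pairwise // s1 /=; apply/andP; split.
    apply/allrelP => a b /(allP s2) ak; rewrite mem_nseq => /andP[_ /eqP->].
    exact: ltW.
  by elim: (i) => //= -[|j] //= ->; rewrite lexx.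
rewrite all_cat; apply/andP; split; first by apply: sub_all s2 => a /ltW.
by rewrite all_nseq lexx orbT.
Qed.

(** Here [None] is the bottom layer [R], whereas in [below] it is the top of the index range. *)
Definition lay (o : option I) : S -> Prop := if o is Some k then Sk1 k else Rp.
Definition layP (P : I -> bool) (o : option I) : Prop := if o is Some k then P k else True.

Lemma lay_dir P o o' : layP P o -> layP P o' ->
  exists l, [/\ layP P l, forall s, lay o s -> lay l s & forall s, lay o' s -> lay l s].
Proof.
case: o o' => [k|] [k'|] /= Pk Pk'.
- have [le|/ltW le] := leP k k'.
    by exists (Some k'); split=> // s; apply: lspan_mono => // a /le_trans; apply.
  by exists (Some k); split=> // s; apply: lspan_mono => // a /le_trans; apply.
- by exists (Some k); split=> // s; apply: lspan_const.
- by exists (Some k'); split=> // s; apply: lspan_const.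
- by exists None.
Qed.

Definition downclosed (P : I -> bool) : Prop := forall s t, (s <= t)%O -> P t -> P s.

(** A standard term lies in the layer of its last, hence largest, variable; the empty term lies in
    [R]. *)
Lemma lspan_lay P f : downclosed P -> lspan x Rp P f <-> exists2 o, layP P o & lay o f.
Proof.
move=> Pd; split=> [|[[k|] /= Pk]]; last 2 first.
- by apply: lspan_mono => // s /Pd; apply.
- exact: lspan_const.
elim/lspan_ind => [|r t g Rr st _ [o Po og]]; first by exists None => //; apply: subring0.
suff [o' Po' ot] : exists2 o, layP P o & lay o (r * term x t).
  have [l [Pl h1 h2]] := lay_dir Po Po'; exists l => //.
  move: (h2 _ ot) (h1 _ og); case: l {Pl h1 h2} => [l|] /= a b.
    exact: lspan_add.
  exact: subringD.
case/lastP: t st => [|t k] /andP[s1 s2]; first by exists None; rewrite /= /term ?big_nil ?mulr1.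
exists (Some k); first by move: s2; rewrite /= all_rcons => /andP[].
rewrite -[_ * _]addr0; apply: lspan_cons => //; last exact: lspan_zero.
rewrite /std s1 /=; move: s1; rewrite -cats1 sorted_pairwise; last by move=> ? ? ?; apply: le_trans.
rewrite pairwise_cat => /and3P[/allrelP h _ _]; rewrite all_cat /= lexx !andbT.
by apply/allP => a at_; apply: h => //; rewrite mem_head.
Qed.

Lemma lt_downclosed k : downclosed (fun s => (s < k)%O).
Proof. by move=> s t; apply: le_lt_trans. Qed.

(** Each [Sk k] is the directed union of [R] and the [Sk1 j] with [j] below [k], so zero, successor
    and limit stages need only the base, the Ore step and unions. *)
Lemma lay_induction (Phi : (S -> Prop) -> Prop) : Phi Rp ->
  (forall k, Phi (Sk k) -> Phi (Sk1 k)) ->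
  (forall P, downclosed P -> (forall o, layP P o -> Phi (lay o)) -> Phi (lspan x Rp P)) ->
  forall P, downclosed P -> Phi (lspan x Rp P).
Proof.
move=> H0 H1 Hu; have wf : well_founded (fun a b : I => (a < b)%O) by case: sp.
have Hk k : Phi (Sk1 k).
  elim/(well_founded_ind wf): k => k IH; apply: H1; apply: Hu; first exact: lt_downclosed.
  by case=> [j|] //= jk; apply: IH.
by move=> P Pd; apply: Hu => // -[k|] _ //; apply: Hk.
Qed.

Lemma lspanT f : lspan x Rp predT f.
Proof. by case: sp => _ [_ []]. Qed.

Lemma lay_ind_elt (Q : S -> Prop) : (forall f, Rp f -> Q f) ->
  (forall k, (forall f, Sk k f -> Q f) -> forall f, Sk1 k f -> Q f) -> forall f, Q f.
Proof.
move=> H0 H1 f; have := lspanT f; move: f.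
apply: (@lay_induction (fun K => forall f, K f -> Q f)) => // P Pd H f /(lspan_lay _ Pd)[o Po].
exact: H.
Qed.

(** A dichotomy for every non-zero [r] is proved by induction on the layer of [f], with an inner
    induction on the layer of [y]. A witness relative to [R] excludes its first alternative. *)
Lemma nonsing_all : nonsing_rel Rp.
Proof.
suff Q f : forall r, Rp r -> r <> 0 -> exists s, [/\ Rp s, s * r <> 0 & s * r * f = 0 \/
    forall y, y * (s * r) <> 0 -> y * (s * r) * f <> 0].
  move=> f /(notZann_witness sR)[r [Rr r0 hr]].
  have [s [Rs sr0 [e|h]]] := Q f r Rr r0; first by case: (hr s).
  by exists (s * r); split=> //; apply: subringM.
elim/lay_ind_elt: f => [f Rf|k IH f Sf] r Rr r0.
  have [[s [Rs sr0 e]]|H] := pselect (exists s, [/\ Rp s, s * r <> 0 & s * r * f = 0]).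
    by exists s; split=> //; left.
  exists 1; rewrite mul1r; split=> //; [exact: subring1|right].
  elim/lay_ind_elt => [y Ry y0 e|k IH y /Sk1_KX]; first by apply: H; exists y.
  by apply: (nonsing_ext (Sk_ore k)); [exact: Rp_Sk|exact: Rp_Sk|exact: IH].
have [|s [Rs sr0 h]] := nonsing_step (Sk_ore k) sR (Rp_Sk k) _ ((Sk1_KX k f).1 Sf) Rr r0.
  move=> g Sg r' Rr' r'0; have [s [Rs sr0 h]] := IH g Sg r' Rr' r'0.
  by exists s; split=> //; case: h => h; [left|right=> y _; apply: h].
exists s; split=> //; case: h => [h|h]; [by left|right].
elim/lay_ind_elt => [y Ry|k' IH' y Sy].
  by apply: h; apply/Sk1_KX; apply: lspan_const.
(* Up to layer [k] the Ore step has already settled the claim; beyond it [f] is a coefficient for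
   the variable [x k'] and [nonsing_ext] applies. *)
have [k'k|kk'] := leP k' k.
  by apply: h; apply/Sk1_KX; apply: lspan_mono Sy => // a /le_trans; apply.
apply: (nonsing_ext (Sk_ore k')); [|by apply: Rp_Sk; apply: subringM|exact: IH'|exact/Sk1_KX].
by apply: lspan_mono Sf => // a /le_lt_trans; apply.
Qed.

(** Flatness of [S] over [R] on the right: the sum of the [S L_j] is direct because the sum of the
    [L_j] is. An arbitrary [A] is allowed, as [A L_j] lies in [S L_j]. *)
Lemma AL_indep (J : eqType) (rs : seq J) (L : J -> S -> Prop) :
  (forall j, j \in rs -> lideal Rp (L j)) ->
  (forall v, (forall j, j \in rs -> L j (v j)) -> \sum_(j <- rs) v j = 0 ->
     forall j, j \in rs -> v j = 0) ->
  forall (A : S -> Prop) v, (forall j, j \in rs -> AL A (L j) (v j)) ->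
    \sum_(j <- rs) v j = 0 -> forall j, j \in rs -> v j = 0.
Proof.
move=> iL ind.
have H : forall P, downclosed P -> forall v, (forall j, j \in rs -> AL (lspan x Rp P) (L j) (v j)) ->
    \sum_(j <- rs) v j = 0 -> forall j, j \in rs -> v j = 0.
  apply: (@lay_induction (fun K => forall v, (forall j, j \in rs -> AL K (L j) (v j)) ->
    \sum_(j <- rs) v j = 0 -> forall j, j \in rs -> v j = 0)).
  - by move=> v hv; apply: ind => j jr; apply: AL_R (iL j jr) (hv j jr).
  - move=> k IH v hv; apply: (indep_step (Sk_ore k) _ IH).
      by move=> j l jr /(lidealS (iL j jr)); apply: Rp_Sk.
    by move=> j /hv; apply: AL_mono => // s /Sk1_KX.
  - move=> P Pd IH v hv.
    have [|||o Po ho] := @union_all S _ (layP P) lay _ (@lay_dir P) J (fun B j => AL B (L j) (v j)) rs.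
    + by exists None.
    + by move=> B C j BC; apply: AL_mono.
    + by move=> j /hv; apply: union_AL; [exists None|exact: lay_dir|move=> f; apply: lspan_lay].
    exact: (IH o Po).
move=> A v hv; apply: (H predT) => // j /hv; apply: AL_mono => // a _; exact: lspanT.
Qed.

(** By freeness, an essential left ideal of [R] killing [f] kills each coefficient. Conversely,
    finitely many essential annihilators intersect in an essential one. *)
Lemma Zann_lspan P f : lspan x Rp P f -> (Zann Rp f <-> lspan x (Zsing Rp) P f).
Proof.
move=> Sf; split=> [[E eE hE]|]; last first.
  elim/lspan_ind => [|r t g [Rr eann] st _ IH]; first exact: Zann0.
  by apply: ZannD => //; apply: ZannMr; exists (fun b => Rp b /\ b * r = 0) => // e [].
have [||ts [c [u hts Rc e]]] := lspan_normal _ _ Sf; [exact: subring0|by move=> *; exact: subringD|].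
have Zc t : t \in ts -> Zsing Rp (c t).
  move=> tin; split=> //; apply/(essential_elt _ sR).
  have [iE eE'] := (essential_elt E sR).1 eE; split.
    split=> [s []//|]; split; first by rewrite mul0r; split=> //; apply: subring0.
    split=> [a b [Ra a0] [Rb b0]|a b Ra [Rb b0]].
      by rewrite mulrDl a0 b0 addr0; split=> //; apply: subringD.
    by rewrite -mulrA b0 mulr0; split=> //; apply: subringM.
  move=> r Rr r0; have [a Ra [n0 Ea]] := eE' r Rr r0.
  exists a => //; split=> //; split; first exact: subringM.
  have [_ [_ [_ [free _]]]] := sp.
  apply: (free ts [seq a * r * c t | t <- ts]) => //.
  - by move=> s /hts; apply: std_mono.
  - by move=> s /mapP[s' _ ->]; apply: subringM => //; apply: subringM.
  - by rewrite size_map.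
  - rewrite -[RHS](hE _ Ea) e mulr_sumr.
    elim: ts {u hts tin e} => [|s ts IH]; first by rewrite !big_nil.
    by rewrite /= !big_cons IH /= mulrA.
  - by apply/mapP; exists t.
rewrite e big_seq; apply: big_ind => [|f1 f2|t tin]; [exact: lspan_zero|exact: lspan_add|].
rewrite -[_ * _]addr0; apply: lspan_cons; [exact: Zc|exact: hts|exact: lspan_zero].
Qed.

(** Carried through the induction beside [good], since the uniform case of the Ore step must find an
    element of [Z] in [L] itself. *)
Definition singular_descent (K : S -> Prop) : Prop := forall L, lideal Rp L ->
  forall z, AL K L z -> z <> 0 -> Zann Rp z -> exists l, [/\ L l, l <> 0 & Zann Rp l].

Lemma good_Zstable k : good Rp (Sk k) -> Zstable Rp (Sk k) (alpha k) (delta k).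
Proof.
move=> gS; have nsR := nonsing_all; have aut := ore_aut (Sk_ore k).
split.
- by move=> p z; apply: (good_ZannM nsR gS (Rp_Sk k)).
- by move=> z; apply: (good_Zann_aut nsR gS (Rp_Sk k) aut).
- by move=> z; apply: (good_Zann_autV nsR gS (Rp_Sk k) aut).
- by move=> z Sz /(Zann_lspan Sz)/Hd.
Qed.

(** The full Ore extension is treated as a special subextension, with [B m] equal to [Sk k], leading
    multipliers the powers of [x k], and [phi m] the iterates of [alpha k]. *)
Lemma good_Sk1 k : good Rp (Sk k) /\ singular_descent (Sk k) -> good Rp (Sk1 k) /\ singular_descent (Sk1 k).
Proof.
move=> [gS sdS]; have oS := Sk_ore k; have RS := Rp_Sk k.
have eK : Sk1 k = KX (Sk k) (x k) by apply/funext => f; apply/propext; apply: Sk1_KX.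
have HZ := good_Zstable gS.
have sdK : singular_descent (Sk1 k).
  by move=> L iL z; rewrite eK; apply: (singular_descent_step RS oS HZ iL); apply: sdS.
split=> //; rewrite eK in sdK *.
have sK := ore_subring oS; have sKX := subring_KX oS.
apply: (@good_At S Rp (Sk k) (x k) (alpha k) (delta k) sR RS oS HZ nonsing_all sdK _
  (fun _ => Sk k) (fun _ => 1) (fun m => iter m (alpha k))) => //.
- by move=> r Rr; apply: D_KX (K_D oS (RS _ Rr)).
- by move=> f i Kf; apply: D_KX (D_monom oS i (cfK oS i Kf)).
- move=> m n _ _ _; exists (1 * x k ^+ (n - m)); have K1 := subring1 sK; split.
  + exact: D_KX (D_monom oS _ K1).
  + exact: (D_monom oS _ K1).
  + by rewrite (cf_monom oS) // eqxx; apply/eqP; apply: oner_neq0.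
move=> m _; have K1 := subring1 sK; split=> //.
- exact: regular1 oS.
- exact: D_KX (D_monom oS _ K1).
- by move=> b Kb; apply: D_KX (K_D oS Kb).
- exact: al_iter oS m.
- move=> p Kp; rewrite !mul1r; apply: (D_pred oS).
    apply: (D_B oS); last exact: (D_monom oS) (alK oS m Kp).
    by have [h _] := mulXn oS m (K_D oS Kp); rewrite addn0 in h.
  have [h1 h2] := mulXn oS m (K_D oS Kp); rewrite addn0 in h1 h2.
  have Ka := alK oS m Kp.
  rewrite (cfB oS); [|exact: D_KX h1|exact: D_KX (D_monom oS m Ka)].
  by rewrite h2 (cf_monom oS) // eqxx (cf_K oS) // subrr.
- move=> q Kq _; exists 1; split=> //; first exact: regular1 oS.
  by exists q => //; rewrite !mul1r.
Qed.

Lemma good_lspan P : downclosed P -> good Rp (lspan x Rp P) /\ singular_descent (lspan x Rp P).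
Proof.
apply: (@lay_induction (fun K => good Rp K /\ singular_descent K)).
- split; first exact: good_R.
  by move=> L iL z /(AL_R iL) Lz z0 Zz; exists z.
- exact: good_Sk1.
move=> Q Qd H; have AP f := lspan_lay f Qd; have ne : exists o, layP Q o by exists None.
split.
  by apply: (good_union ne (@lay_dir Q) AP) => o /H[].
move=> L iL z /(union_AL ne (@lay_dir Q) AP)[o Po Lz].
by have [_] := H o Po; apply.
Qed.

Lemma Deg_Degs k At m : (forall f, At f -> Sk1 k f) ->
  Deg Rp x k At m <-> Degs (Sk k) (x k) At m.
Proof.
move=> AtS; have oS := Sk_ore k; split=> [[f [Af [f0 [ps [sz [hps [l0 ef]]]]]]]|[f [Af Df fm0]]].
  have sc := xpoly_spec hps; rewrite -ef in sc; exists f; split=> //.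
    apply/(D_spec oS); split; first exact: spec_KX sc.
    by move=> i mi; rewrite (cf_uniq oS sc) nth_default // sz.
  by rewrite (cf_uniq oS sc) -[m]/(m.+1.-1) -sz nth_last.
exists f; split=> //; split; first by move=> e; apply: fm0; rewrite e (cf0 oS).
exists (mkseq (cf (Sk k) (x k) f) m.+1); split; first by rewrite size_mkseq.
split; first by move=> p /mapP[j _ ->]; apply: (cfK oS) (D_KX Df).
split; first by rewrite -nth_last size_mkseq nth_mkseq.
rewrite /xpoly size_mkseq {1}(D_sum oS Df); apply: eq_bigr => i _.
by rewrite nth_mkseq.
Qed.

Lemma good_special k At B : special Rp x k At B ->
  (forall m, Deg Rp x k At m -> good Rp (B m)) -> good Rp At.
Proof.
move=> [sAt [RAt [AtS [Atgr [[g [_ hg]] [lam B0]]]]]] gB.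
have oS := Sk_ore k; have RS := Rp_Sk k; have [gS sdS] := good_lspan (@lt_downclosed k).
have eK : Sk1 k = KX (Sk k) (x k) by apply/funext => f; apply/propext; apply: Sk1_KX.
have [_ sdK] := good_Sk1 (conj gS sdS); rewrite eK in sdK.
have HZ := good_Zstable gS.
have AtKX f : At f -> KX (Sk k) (x k) f by move/AtS/Sk1_KX.
have Dgp m := Deg_Degs m AtS.
have /choice[uf Huf] : forall m, exists uf : S * (S -> S), Degs (Sk k) (x k) At m ->
    lam_data Rp (Sk k) (x k) At B (fun _ => uf.1) (fun _ => uf.2) m.
  (* In degree zero [special] fixes only the ring [B 0]; the data [1] and [id] are supplied here. *)
  case=> [|m].
    exists (1, id) => _; have K1 := subring1 (ore_subring oS); split=> /=.
    - exact: regular1 oS.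
    - by rewrite mulr1; apply: subring1.
    - by move=> r Rr; apply/B0; split; [apply: RAt|apply: RS].
    - by move=> b /B0[].
    - by move=> b /B0[].
    - by do !split => //; move=> b Bb; exists b.
    - by move=> p _; rewrite !mulr1 mul1r subrr; apply: (D_zero oS).
    - move=> q Kq; rewrite mulr1 => Aq; exists 1.
      have B1 : B 0%N 1 by apply/B0; split=> //; apply: subring1.
      split=> //; first exact: regular1 oS.
      by exists q; [apply/B0|rewrite !mulr1 mul1r].
  (* Outside the degree set the condition is vacuous and the pair [(0, id)] is a default. *)
  have [Dm|nD] := pselect (Degs (Sk k) (x k) At m.+1); last by exists (0, id).
  have [//|ups [alm [h1 [h2 [_ [h4 [h5 [h6 [h7 h8]]]]]]]]] := lam m.+1 ((Dgp _).2 Dm) _.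
  exists (ups, alm) => _; split=> //=.
  - by move=> b /h5[].
  - by move=> b /h5[].
  - move=> p Bp; have [ps [sz [hps ->]]] := h7 p Bp; apply: (D_mono oS sz).
    by exists (nth 0 ps); [case: (xpoly_spec hps)|].
  - move=> q Kq Aq; have [u [Bu [ru [b [Bb e]]]]] := h8 q Kq Aq.
    by exists u; split=> //; exists b.
apply: (@good_At S Rp (Sk k) (x k) (alpha k) (delta k) sR RS oS HZ nonsing_all sdK At B
  (fun m => (uf m).1) (fun m => (uf m).2)) => //.
- move=> f i Af; have [ps [hps [ef h]]] := Atgr f Af.
  by have sc := xpoly_spec hps; rewrite -ef in sc; rewrite (cf_uniq oS sc).
(* The degrees are exactly the multiples of [g], hence closed under subtraction. *)
- move=> m n /Dgp/hg gm /Dgp/hg gn mn; apply/Dgp/hg.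
  by rewrite dvdn_subr.
- by move=> m /Huf[*]; split.
- by move=> m /Dgp/gB.
Qed.

Lemma ess_special_good c A : ess_special Rp x c A -> good Rp A.
Proof.
elim=> {c A} [c A _ nA|c A Lam F _ _ _ ne Fm _ IH AF|c k A At B _ spc nA _ IH].
- by apply: good_nicely nA => //; apply: good_R.
- apply: (good_union (P := Lam) (G := F)) => //.
    move=> i j Li Lj; have [ij|/ltW ji] := leP i j; [exists j|exists i]; split=> //.
      exact: (Fm _ _ Li Lj ij).
    exact: (Fm _ _ Lj Li ji).
  by move=> f; split=> [/AF[e [? ?]]|[e ? ?]]; [exists e|apply/AF; exists e].
- apply: (good_nicely (B := At)) nA; first exact: good_special spc IH.
  by case: spc => _ [].
Qed.

End Multi.

(** * Uniform dimension *)

Section UniformDimension.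
Variables (S : nzRingType) (A : S -> Prop).
Hypothesis sA : subring A.

Definition sumI n (U : 'I_n -> S -> Prop) (s : S) : Prop :=
  exists2 v : 'I_n -> S, (forall i, U i (v i)) & s = \sum_(i < n) v i.
Definition indep n (U : 'I_n -> S -> Prop) : Prop :=
  forall v : 'I_n -> S, (forall i, U i (v i)) -> \sum_(i < n) v i = 0 -> forall i, v i = 0.
Definition cyc (f s : S) : Prop := exists2 a, A a & s = a * f.

Lemma sumI_lideal n (U : 'I_n -> S -> Prop) : (forall i, lideal A (U i)) -> lideal A (sumI U).
Proof.
move=> iU; split.
  by move=> _ [v hv ->]; apply: subring_sum => // i _; apply: lidealS (iU i) (hv i).
split; first by exists (fun _ => 0) => [i|]; [apply: lideal0 (iU i)|rewrite big1].
split=> [_ _ [v hv ->] [w hw ->]|a _ Aa [v hv ->]].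
  exists (fun i => v i + w i); last by rewrite big_split.
  by move=> i; apply: lidealD (iU i) (hv i) (hw i).
exists (fun i => a * v i); last by rewrite mulr_sumr.
by move=> i; apply: lidealM (iU i) Aa (hv i).
Qed.

Lemma sumI_one n (U : 'I_n -> S -> Prop) i s : (forall i, lideal A (U i)) -> U i s -> sumI U s.
Proof.
move=> iU Us; exists (fun j => if j == i then s else 0).
  by move=> j; case: eqP => [->//|_]; apply: lideal0 (iU j).
by rewrite -big_mkcond big_pred1_eq.
Qed.

Definition extend n (i0 : 'I_n.+1) (T : Type) (t0 : T) (v : 'I_n -> T) (i : 'I_n.+1) : T :=
  if unlift i0 i is Some j then v j else t0.

Lemma extend0 n (i0 : 'I_n.+1) (T : Type) (t0 : T) v : extend i0 t0 v i0 = t0.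
Proof. by rewrite /extend unlift_none. Qed.
Lemma extendS n (i0 : 'I_n.+1) (T : Type) (t0 : T) v i : extend i0 t0 v (lift i0 i) = v i.
Proof. by rewrite /extend liftK. Qed.
Lemma extend_sum n (i0 : 'I_n.+1) (s0 : S) v :
  \sum_(i < n.+1) extend i0 s0 v i = s0 + \sum_(i < n) v i.
Proof.
rewrite (bigD1_ord i0) //= extend0; congr (_ + _).
by apply: eq_bigr => i _; rewrite extendS.
Qed.

Lemma indep_cons n (i0 : 'I_n.+1) (U : 'I_n.+1 -> S -> Prop) s v : indep U -> U i0 s ->
  (forall i, U (lift i0 i) (v i)) -> s + \sum_(i < n) v i = 0 -> s = 0 /\ forall i, v i = 0.
Proof.
move=> indU Us Uv e.
have H : forall i, extend i0 s v i = 0.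
  apply: indU; last by rewrite extend_sum.
  by move=> i; case: (unliftP i0 i) => [j|] ->; rewrite ?extendS ?extend0.
by split=> [|i]; [have := H i0|have := H (lift i0 i)]; rewrite ?extendS ?extend0.
Qed.

Lemma indep_lift n (i0 : 'I_n.+1) (U : 'I_n.+1 -> S -> Prop) : (forall i, lideal A (U i)) ->
  indep U -> indep (fun i => U (lift i0 i)).
Proof.
move=> iU indU v hv e.
by have [] := indep_cons indU (lideal0 (iU i0)) hv (etrans (add0r _) e).
Qed.

(* If U_i misses K' = K_1 + ... + K_n, then projecting away from U_i embeds K'
   in the sum of the remaining U's, which lowers both counts by one. *)
Lemma goldie n (U : 'I_n -> S -> Prop) (K : 'I_n.+1 -> S -> Prop) :
  (forall i, uniform_lideal A (U i)) -> indep U ->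
  (forall j, lideal A (K j) /\ nonzero (K j)) -> indep K ->
  (forall j s, K j s -> sumI U s) -> False.
Proof.
elim: n U K => [|n IH] U K uU indU hK indK KU.
  have [_ [l [Kl l0]]] := hK ord0; apply: l0.
  by have [v _ ->] := KU _ _ Kl; rewrite big_ord0.
have iU i : lideal A (U i) by case: (uU i).
have iK j : lideal A (K j) by case: (hK j).
pose K' := sumI (fun j => K (lift ord0 j)).
have iK' : lideal A K' by apply: sumI_lideal.
have K0K' s : K ord0 s -> K' s -> s = 0.
  move=> Ks [w hw es].
  have [||s0 _] := indep_cons (s := - s) indK _ hw; first exact: (lidealN sA (iK ord0)).
    by rewrite es addNr.
  by apply/eqP; rewrite -oppr_eq0 s0.
(* If every [U i] met [K'], the components of a non-zero [v] in [K ord0] could be multiplied into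
   [K'] one after another without killing [v], giving a non-zero element of [K ord0] in [K']. *)
have [i0 Hi0] : exists i, forall s, U i s -> K' s -> s = 0.
  apply: contrapT => /forallNP H.
  have {}H i : exists s, [/\ U i s, K' s & s <> 0].
    apply: contrapT => H'; apply: (H i) => s Us K's; apply: contrapT => s0.
    by apply: H'; exists s.
  have [_ [v [Kv v0]]] := hK ord0; have [u hu ev] := KU _ _ Kv.
  have [a Aa [av0 ha]] : exists2 a, A a & a * v <> 0 /\
      forall i, i \in enum 'I_n.+1 -> K' (a * u i).
    elim: (enum _) => [|i l [a Aa [av0 ha]]].
      by exists 1; [apply: subring1|rewrite mul1r].
    have Uau j : U j (a * u j) by apply: (lidealM (iU j)).
    have [e|/eqP aui] := eqVneq (a * u i) 0.
      exists a => //; split=> // j; rewrite inE => /orP[/eqP->|/ha//].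
      by rewrite e; apply: lideal0 iK'.
    have [s [Us K's s0]] := H i; have [_ _ uni] := (uniform_elt (U i) sA).1 (uU i).
    have [b [c [Ab Ac e n0]]] := uni _ _ (Uau i) Us aui s0.
    exists (b * a); first exact: subringM.
    split.
      rewrite ev mulr_sumr => e0; apply: n0; rewrite mulrA.
      apply: (indU (fun i => b * a * u i)) => // j.
      by rewrite -mulrA; apply: (lidealM (iU j)).
    move=> j; rewrite -mulrA inE => /orP[/eqP->|/ha]; last exact: lidealM iK' Ab.
    by rewrite e; apply: (lidealM iK').
  apply: av0; apply: K0K'; first exact: (lidealM (iK ord0)).
  rewrite ev mulr_sumr; apply: (lideal_sum iK') => i _; apply: ha.
  by rewrite mem_enum.
pose U' i := U (lift i0 i).
(* [K2 j] is the image of [K (lift ord0 j)] under the projection along [U i0]. *)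
pose K2 j w := sumI U' w /\ exists2 u, U i0 u & K (lift ord0 j) (w + u).
have iU' : lideal A (sumI U') by apply: sumI_lideal => i; apply: iU.
have KK' j s : K (lift ord0 j) s -> K' s.
  by move=> Ks; apply: (@sumI_one n.+1 (fun j => K (lift ord0 j)) j).
apply: (IH U' K2).
- by move=> i; apply: uU.
- exact: indep_lift.
- move=> j; split.
    split; first by move=> s [/(lidealS iU')].
    split.
      split; first exact: lideal0 iU'.
      by exists 0; [apply: lideal0 (iU i0)|rewrite addr0; apply: lideal0 (iK _)].
    split=> [s t [Us [u Uu Ku]] [Ut [u' Uu' Ku']]|a s Aa [Us [u Uu Ku]]].
      split; first exact: (lidealD iU').
      exists (u + u'); first exact: (lidealD (iU i0)).
      by rewrite addrACA; apply: (lidealD (iK _)).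
    split; first exact: (lidealM iU').
    by exists (a * u); [apply: (lidealM (iU i0))|rewrite -mulrDr; apply: (lidealM (iK _))].
  have [_ [s [Ks s0]]] := hK (lift ord0 j); have [v hv es] := KU _ _ Ks.
  rewrite (bigD1_ord i0) //= in es.
  exists (\sum_(i < n) v (lift i0 i)); split.
    split; first by exists (fun i => v (lift i0 i)) => // i; apply: hv.
    by exists (v i0) => //; rewrite addrC -es.
  move=> e; rewrite e addr0 in es; apply: s0; apply: Hi0; first by rewrite es.
  exact: KK' Ks.
(* The [U i0] components add up to an element of [K'], which is zero. Independence of the [K j] then
   kills each [w j + u j], and independence of the [U i] each [w j]. *)
- move=> w hw e.
  have /choice[u Hu] : forall j, exists u, U i0 u /\ K (lift ord0 j) (w j + u).
    by move=> j; have [_ [u Uu Ku]] := hw j; exists u.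
  have Uu j : U i0 (u j) by case: (Hu j).
  have Ku j : K (lift ord0 j) (w j + u j) by case: (Hu j).
  have Eu : \sum_j (w j + u j) = \sum_j u j by rewrite big_split /= e add0r.
  have u0 : \sum_j u j = 0.
    apply: Hi0; first by apply: (lideal_sum (iU i0)) => j _.
    by rewrite -Eu; exists (fun j => w j + u j).
  have wu := indep_lift iK indK Ku (etrans Eu u0).
  move=> j; have [[v hv ew] _] := hw j.
  have [|_ v0] := indep_cons indU (Uu j) hv; first by rewrite addrC -ew.
  by rewrite ew big1.
- by move=> j s [].
Qed.

Lemma cyc_lideal f : A f -> lideal A (cyc f).
Proof. exact: lideal_cyc. Qed.

(** Induction on a list containing the support. If some [a] kills one component but not the sum, the
    support shrinks. Otherwise the sum and that component have the same annihilator, so the sum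
    generates a left ideal isomorphic to one inside the uniform [M t]. *)
Lemma uniform_in_sum (J : eqType) (rs : seq J) (M : J -> S -> Prop) :
  (forall j, j \in rs -> uniform_lideal A (M j)) ->
  (forall v, (forall j, j \in rs -> M j (v j)) -> \sum_(j <- rs) v j = 0 ->
     forall j, j \in rs -> v j = 0) ->
  forall g, (forall j, j \in rs -> M j (g j)) -> \sum_(j <- rs) g j <> 0 ->
  exists U, uniform_lideal A U /\ forall s, U s -> cyc (\sum_(j <- rs) g j) s.
Proof.
move=> uM ind.
have iM j : j \in rs -> lideal A (M j) by move=> /uM[].
suff H : forall (ts : seq J) g, (forall j, j \in rs -> M j (g j)) -> \sum_(j <- rs) g j <> 0 ->
    (forall j, j \in rs -> g j <> 0 -> j \in ts) ->
    exists U, uniform_lideal A U /\ forall s, U s -> cyc (\sum_(j <- rs) g j) s.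
  by move=> g hg n0; apply: (H rs g).
elim=> [|t ts IH] g hg n0 hts.
  case: n0; rewrite big_seq big1 // => j jr; apply: contrapT => gj.
  by have := hts j jr gj.
have [tr|tnr] := boolP (t \in rs); last first.
  apply: IH => // j jr gj; have := hts j jr gj; rewrite inE => /orP[/eqP jt|//].
  by rewrite -jt jr in tnr.
have AS : A (\sum_(j <- rs) g j).
  by rewrite big_seq; apply: subring_sum => // j jr; apply: lidealS (iM j jr) (hg j jr).
have [[a [Aa at0 af0]]|H] := pselect (exists a, [/\ A a, a * g t = 0 &
    a * \sum_(j <- rs) g j <> 0]).
  rewrite mulr_sumr in af0.
  have [||U [uU hU]] := IH (fun j => a * g j) _ af0.
  - by move=> j jr; apply: (lidealM (iM j jr)) => //; apply: hg.
  - move=> j jr gj; have : g j <> 0 by move=> e; apply: gj; rewrite e mulr0.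
    move/(hts j jr); rewrite inE => /orP[/eqP jt|//].
    by rewrite jt in gj.
  exists U; split=> // s /hU[b Ab ->]; exists (b * a); first exact: subringM.
  by rewrite -mulr_sumr mulrA.
have {}H a : A a -> a * g t = 0 -> a * \sum_(j <- rs) g j = 0.
  by move=> Aa e; apply: contrapT => n1; apply: H; exists a.
set f := \sum_(j <- rs) g j in n0 AS H *.
exists (cyc f); split=> //; apply/(uniform_elt _ sA); split; first exact: cyc_lideal.
  by exists f; split=> //; apply: cyc_self.
move=> _ _ [b Ab ->] [c Ac ->] b0 c0.
have [_ _ uni] := (uniform_elt (M t) sA).1 (uM t tr).
have Mg a : A a -> M t (a * g t) by move=> Aa; apply: (lidealM (iM t tr)) => //; apply: hg.
have nz a : A a -> a * f <> 0 -> a * g t <> 0 by move=> Aa n1 e; apply: n1; apply: H.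
have [p [q [Ap Aq e n1]]] := uni _ _ (Mg _ Ab) (Mg _ Ac) (nz _ Ab b0) (nz _ Ac c0).
have Apb := subringM sA Ap Ab; have Aqc := subringM sA Aq Ac.
exists p, q; split=> //.
  apply/eqP; rewrite -subr_eq0 !mulrA -mulrBl; apply/eqP; apply: H; first exact: subringB.
  by rewrite mulrBl -!mulrA e subrr.
rewrite mulrA /f mulr_sumr => e0; apply: n1; rewrite mulrA.
apply: (ind (fun j => p * b * g j)) => // j jr.
by apply: (lidealM (iM j jr)) => //; apply: hg.
Qed.

Lemma udim_geS n : udim_ge A n.+1 -> udim_ge A n.
Proof.
move=> [L [hL indL]]; exists (fun i => L (lift ord0 i)); split=> [i|]; first exact: hL.
by apply: (indep_lift (i0 := ord0)) => // i; case: (hL i).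
Qed.

Lemma udim_ge_mono m n : (m <= n)%N -> udim_ge A n -> udim_ge A m.
Proof.
elim: n => [|n IH]; first by rewrite leqn0 => /eqP->.
by rewrite leq_eqVlt => /orP[/eqP->//|mn /udim_geS]; apply: IH.
Qed.

Lemma udim_ge0 : udim_ge A 0.
Proof. by exists (fun _ => A); split=> [[]//|v _ _ []//]. Qed.

Lemma udim_threshold n : ~ udim_ge A n ->
  exists m, [/\ (m < n)%N, udim_ge A m & ~ udim_ge A m.+1].
Proof.
elim: n => [/(_ udim_ge0)//|n IH] nn.
have [un|/IH[m [mn h1 h2]]] := pselect (udim_ge A n); first by exists n.
by exists m; split=> //; apply: ltnW.
Qed.

(** A family of maximal length is shrunk to uniform members. A cyclic left ideal missing their sum
    could be adjoined, contradicting maximality. *)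
Lemma udim_finite_uniform m : enough_uniform A -> udim_ge A m -> ~ udim_ge A m.+1 ->
  exists U : 'I_m -> S -> Prop, [/\ forall i, uniform_lideal A (U i), indep U &
    essential_lideal A (sumI U)].
Proof.
move=> eu [L [hL indL]] nu.
have /choice[U HU] : forall i, exists U, uniform_lideal A U /\ forall s, U s -> L i s.
  by move=> i; have [iL nL] := hL i; apply: eu.
have uU i : uniform_lideal A (U i) by case: (HU i).
have UL i s : U i s -> L i s by case: (HU i) => _; apply.
have iU i : lideal A (U i) by case: (uU i).
have indU : indep U by move=> v hv; apply: indL => i; apply: UL.
exists U; split=> //; apply/(essential_elt _ sA); split; first exact: sumI_lideal.
move=> f Af f0; apply: contrapT => H; apply: nu.
exists (extend ord0 (cyc f) U); split.
  move=> i; case: (unliftP ord0 i) => [j|] ->; rewrite ?extendS ?extend0.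
    by have [iL [nL _]] := uU j.
  by split; [apply: cyc_lideal|exists f; split=> //; apply: cyc_self].
move=> v hv; rewrite big_ord_recl => e.
have v0 : v ord0 = 0.
  have := hv ord0; rewrite extend0 => -[a Aa ea]; rewrite ea; apply: contrapT => n0.
  apply: H; exists a => //; split=> //; rewrite -ea.
  exists (fun i => - v (lift ord0 i)).
    by move=> i; apply: (lidealN sA (iU i)); have := hv (lift ord0 i); rewrite extendS.
  by rewrite sumrN; apply/eqP; rewrite -addr_eq0; apply/eqP.
have vS : forall i, v (lift ord0 i) = 0.
  apply: indU => [i|]; first by have := hv (lift ord0 i); rewrite extendS.
  by rewrite v0 add0r in e.
by move=> i; case: (unliftP ord0 i) => [j|] ->.
Qed.

End UniformDimension.

(** * Maximal independent families of cyclic uniform left ideals *)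

Section EnoughUniform.
Variables (S : nzRingType) (Rp : S -> Prop).
Hypothesis sR : subring Rp.

(** A family of left ideals is encoded by its set of generators, so that inclusion of sets is the
    order for Zorn's lemma. *)
Definition indep_set (F : set S) : Prop :=
  (forall r, F r -> Rp r /\ uniform_lideal Rp (cyc Rp r)) /\
  forall rs : seq S, uniq rs -> (forall r, r \in rs -> F r) ->
    forall v : S -> S, (forall r, r \in rs -> cyc Rp r (v r)) -> \sum_(r <- rs) v r = 0 ->
    forall r, r \in rs -> v r = 0.

(** The empty list is a separate case because the chain itself may be empty. *)
Lemma chain_seq (F : set (set S)) (rs : seq S) : total_on F subset ->
  (forall r, r \in rs -> exists2 X, F X & X r) ->
  rs = [::] \/ exists2 X, F X & forall r, r \in rs -> X r.
Proof.
move=> tot; elim: rs => [|r rs IH] h; [by left|right].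
have [X FX Xr] := h r (mem_head _ _).
have [|e|[Y FY hY]] := IH; first by move=> s srs; apply: h; rewrite inE srs orbT.
  by exists X => // s; rewrite e inE => /eqP->.
have [XY|YX] := tot X Y FX FY.
  by exists Y => // s; rewrite inE => /orP[/eqP->|/hY//]; apply: XY.
by exists X => // s; rewrite inE => /orP[/eqP->//|/hY/YX].
Qed.

(** For a maximal [F], a cyclic left ideal missing the left ideal generated by [F] would contain a
    uniform one, any non-zero element of which could be added to [F]. *)
Lemma essential_indep_set : enough_uniform Rp ->
  exists2 F, indep_set F & essential_lideal Rp (AL Rp F).
Proof.
move=> eu; have [Fs FsP tot|F [PF maxF]] := @Zorn_bigcup S indep_set.
  split; first by move=> r [X FX Xr]; have [h _] := FsP X FX; apply: h.
  move=> rs u hrs; have [|->//|[X FX hX]] := chain_seq (rs := rs) tot; first by move=> r /hrs[X]; exists X.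
  by have [_] := FsP X FX; apply.
exists F => //; have [uF indF] := PF.
have iF : lideal Rp (AL Rp F).
  split; first by move=> s; apply: AL_sub => // r /uF[].
  split; first exact: AL_zero.
  by split=> [*|*]; [apply: AL_add|apply: AL_mull].
apply/(essential_elt _ sR); split=> // f Rf f0.
have [|U [uU Uf]] := eu _ (lideal_cyc sR Rf); first by exists f; split=> //; apply: cyc_self.
have [iU nU uni] := (uniform_elt U sR).1 uU; have [r [Ur r0]] := nU.
have Rr := lidealS iU Ur; have [b Rb erb] := Uf r Ur.
apply: contrapT => H.
have Hr s : Rp s -> AL Rp F (s * r) -> s * r = 0.
  move=> Rs Fs; apply: contrapT => n0; apply: H.
  by exists (s * b); [apply: subringM|rewrite -mulrA -erb].
have nFr : ~ F r.
  move=> Fr; apply: r0; rewrite -[r]mul1r; apply: Hr; first exact: subring1.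
  by apply: AL_mul1 => //; apply: subring1.
apply: (maxF (fun s => F s \/ s = r)).
  split; first by move=> s; left.
  by move=> h; apply: nFr; apply: h; right.
split.
  move=> s [/uF//|->]; split=> //; apply/(uniform_elt _ sR); split; first exact: lideal_cyc.
    by exists r; split=> //; apply: cyc_self.
  by move=> _ _ [a Ra ->] [c Rc ->]; apply: uni; apply: (lidealM iU).
move=> rs u hrs v hv e.
have hF s : s \in [seq s <- rs | s != r] -> F s.
  by rewrite mem_filter => /andP[/eqP sr /hrs[]].
have sumF : AL Rp F (\sum_(s <- [seq s <- rs | s != r]) v s).
  apply: AL_sum => s sin; have sr : s \in rs by move: sin; rewrite mem_filter => /andP[].
  by have [a Ra ->] := hv s sr; apply: AL_mul1 => //; apply: hF.
have [rin|rnin] := boolP (r \in rs); last first.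
  apply: indF => // s srs; have [//|es] := hrs s srs.
  by rewrite -es srs in rnin.
rewrite (bigD1_seq r) //= -big_filter in e.
have vr : v r = 0.
  have [a Ra ea] := hv r rin; rewrite ea; apply: Hr => //; rewrite -ea.
  have /eqP := e; rewrite addr_eq0 => /eqP->; exact: AL_opp.
move=> s srs; have [->//|sr] := eqVneq s r.
apply: (indF [seq s <- rs | s != r]) => //; [exact: filter_uniq| | |].
- by move=> t; rewrite mem_filter => /andP[_ /hv].
- by rewrite vr add0r in e.
- by rewrite mem_filter sr.
Qed.

Definition sum_over (F : S -> Prop) (M : S -> S -> Prop) (h : S) : Prop :=
  exists (rs : seq S) (g : S -> S), [/\ uniq rs, forall r, r \in rs -> F r,
    forall r, M r (g r) & h = \sum_(r <- rs) g r].

(** Both sums are extended by zero to the union of their index lists. *)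
Lemma sum_over_add (F : S -> Prop) (M : S -> S -> Prop) (h h' : S) :
  (forall r, M r 0) -> (forall r s t, M r s -> M r t -> M r (s + t)) ->
  sum_over F M h -> sum_over F M h' -> sum_over F M (h + h').
Proof.
move=> M0 MD [rs [g [u hF hM ->]]] [rs' [g' [u' hF' hM' ->]]].
pose T := undup (rs ++ rs').
have restr (r1 : seq S) (g1 : S -> S) : uniq r1 -> {subset r1 <= T} ->
    \sum_(r <- r1) g1 r = \sum_(r <- T) (if r \in r1 then g1 r else 0).
  move=> u1 s1; rewrite -big_mkcond -big_filter; apply: perm_big; apply: uniq_perm => //.
    by apply: filter_uniq; apply: undup_uniq.
  by move=> r; rewrite mem_filter; case rr: (r \in r1) => //=; rewrite s1.
exists T, (fun r => (if r \in rs then g r else 0) + (if r \in rs' then g' r else 0)); split.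
- exact: undup_uniq.
- by move=> r; rewrite mem_undup mem_cat => /orP[/hF|/hF'].
- by move=> r; apply: MD; case: ifP.
- rewrite big_split /=; congr (_ + _); apply: restr => // r rr.
    by rewrite mem_undup mem_cat rr.
  by rewrite mem_undup mem_cat rr orbT.
Qed.

(** Summands are regrouped by generator, giving one component per generator as [uniform_in_sum]
    requires. *)
Lemma AL_AL_cyc (A : S -> Prop) (F : set S) h : subring A -> indep_set F -> AL A (AL Rp F) h ->
  sum_over F (fun r => AL A (cyc Rp r)) h.
Proof.
move=> sA PF.
have M0 r : AL A (cyc Rp r) 0 by exact: AL_zero.
have MD r s t : AL A (cyc Rp r) s -> AL A (cyc Rp r) t -> AL A (cyc Rp r) (s + t).
  exact: AL_add.
elim/AL_ind => [|a l f Aa Ll _ IH].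
  by exists [::], (fun _ => 0); rewrite big_nil.
apply: sum_over_add => //; elim/AL_ind: l / Ll => [|b r l Rb Fr _ IHl].
  by rewrite mulr0; exists [::], (fun _ => 0); rewrite big_nil.
rewrite mulrDr; apply: sum_over_add => //.
exists [:: r], (fun s => if s == r then a * (b * r) else 0); split=> //.
- by move=> s; rewrite inE => /eqP->.
- by move=> s; case: eqP => [->|_] //; apply: AL_mul1 => //; exists b.
- by rewrite big_seq1 eqxx.
Qed.

End EnoughUniform.

(** * Left ideals, singular ideal and uniform dimension of an essentially special subextension *)

Theorem mainTheorem16 (S : nzRingType) (d : Order.disp_t) (I : orderType d)
  (Rp : S -> Prop) (x : I -> S) (alpha delta : I -> S -> S) (A : S -> Prop) :
  skew_poly_bijective Rp x alpha delta ->
  (forall (k : I) (f : S), lspan x (Zsing Rp) (fun s => (s < k)%O) f -> delta k f = 0) ->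
  ess_special Rp x None A ->
  (forall L, uniform_lideal Rp L -> uniform_lideal A (fun f => A f /\ AL A L f)) /\
  (forall L, essential_lideal Rp L -> essential_lideal A (fun f => A f /\ AL A L f)) /\
  (forall f, Zsing A f <-> A f /\ lspan x (Zsing Rp) predT f) /\
  (enough_uniform Rp -> enough_uniform A /\ udim A = udim Rp).
Proof.
move=> sp Hd esA; have gA := ess_special_good sp Hd esA.
have sR : subring Rp by case: sp => _ [].
have sA := good_subring gA; have nsR := nonsing_all sp.
have iAL L : lideal A (fun f => A f /\ AL A L f).
  split=> [f []//|]; split; first by split; [apply: subring0|apply: AL_zero].
  split=> [f g [Af Lf] [Ag Lg]|a f Aa [Af Lf]].
    by split; [apply: subringD|apply: AL_add].
  by split; [apply: subringM|apply: AL_mull].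
(* [A L] need not lie in [A]; [good_nice] multiplies a non-zero element of [L] into [A]. *)
have nzAL L : lideal Rp L -> nonzero L -> nonzero (fun f => A f /\ AL A L f).
  move=> iL [l [Ll l0]]; have [|a Aa ha] := good_nice gA (E := [:: l]).
    by move=> e; rewrite inE => /eqP->; apply: AL_one => //; apply: lidealS iL Ll.
  have [Aal n0] := ha l (mem_head _ _).
  by exists (a * l); split; [split=> //; apply: AL_mul1|apply: n0].
have uniA L : uniform_lideal Rp L -> uniform_lideal A (fun f => A f /\ AL A L f).
  move=> uL; have [iL [nL _]] := uL; apply/(uniform_elt _ sA); split=> //; first exact: nzAL.
  by move=> f g [_ Lf] [_ Lg]; apply: (good_uniform gA uL).
have essA L : essential_lideal Rp L -> essential_lideal A (fun f => A f /\ AL A L f).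
  move=> eL; apply/(essential_elt _ sA); split=> // f Af f0.
  have [a Aa [n0 La]] := good_essential gA eL Af f0.
  by exists a => //; split=> //; split=> //; apply: subringM.
split=> //; split=> //; split.
  move=> f; rewrite -(Zann_lspan sp (lspanT sp f)).
  split=> [[Af /(essential_elt _ sA)[_ eann]]|[Af [E eE hE]]].
    (* The annihilator of [f] in [A] is essential, so it contains a non-zero multiple of an element
       of [A] lying in [A R r]. That multiple has the form [y * r] with [y] only known to be in [S],
       which is why the witness must resist all of [S]. *)
    split=> //; apply: contrapT => /nsR[r [Rr r0 hr]].
    have nr : nonzero (cyc Rp r) by exists r; split=> //; apply: cyc_self.
    have [l [[Al Ll] l0]] := nzAL _ (lideal_cyc sR Rr) nr.
    have [a Aa [n0 [_ e]]] := eann l Al l0.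
    have [y ey] : exists y, a * l = y * r.
      elim/AL_ind: l / Ll {Al l0 n0 e} => [|b _ l _ [c _ ->] _ [y ey]].
        by exists 0; rewrite mulr0 mul0r.
      by exists (a * b * c + y); rewrite mulrDr ey mulrDl !mulrA.
    by apply: (hr y); rewrite -ey.
  split=> //; apply/(essential_elt _ sA); split.
    split=> [s []//|]; split; first by rewrite mul0r; split=> //; apply: subring0.
    split=> [a b [Aa a0] [Ab b0]|a b Aa [Ab b0]].
      by rewrite mulrDl a0 b0 addr0; split=> //; apply: subringD.
    by rewrite -mulrA b0 mulr0; split=> //; apply: subringM.
  move=> g Ag g0; have [a Aa [n0 La]] := good_essential gA eE Ag g0.
  exists a => //; split=> //; split; first exact: subringM.
  exact: (Zann_AL hE La).
move=> eu; split.
  have [F PF eF] := essential_indep_set sR eu; have [uF indF] := PF.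
  move=> K iK [f [Kf f0]]; have Af := lidealS iK Kf.
  have [a Aa [n0 La]] := good_essential gA eF Af f0.
  have [rs [g [u hF hM e]]] := AL_AL_cyc sA PF La.
  have cycR r s : r \in rs -> cyc Rp r s -> Rp s.
    by move=> /hF/uF[Rr _] [b Rb ->]; apply: subringM.
  (* One multiplier brings the product and all its components into [A] without killing the
     product. *)
  have [|a' Aa' ha] := good_nice gA (E := a * f :: map g rs).
    move=> s; rewrite inE => /orP[/eqP->|/mapP[r rr ->]].
      by apply: AL_mono La => // l; apply: AL_sub => // r /uF[].
    by apply: AL_mono (hM r) => // l; apply: cycR.
  have [_ n1] := ha (a * f) (mem_head _ _).
  have Ag r : r \in rs -> A (a' * g r).
    by move=> rr; have [] := ha (g r) _; rewrite // inE map_f ?orbT.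
  have ef : \sum_(r <- rs) a' * g r = a' * (a * f) by rewrite e mulr_sumr.
  have [||||U [uU hU]] := @uniform_in_sum S A sA S rs
      (fun r s => A s /\ AL A (cyc Rp r) s) _ _ (fun r => a' * g r).
  - by move=> r /hF/uF[_]; apply: uniA.
  - move=> v hv; apply: (@AL_indep _ _ _ _ _ _ _ sp _ rs (cyc Rp) _ _ A v).
    + by move=> r /hF/uF[Rr _]; apply: lideal_cyc.
    + exact: (indF rs u hF).
    + by move=> r /hv[].
  - by move=> r rr; split; [apply: Ag|apply: AL_mull].
  - by rewrite ef; apply: n1.
  exists U; split=> // s /hU[b Ab ->]; rewrite ef.
  by do 3?apply: (lidealM iK).
(* [udim] is a choice determined by [udim_ge], so equality of these predicates suffices, in the
   infinite case too. *)
suff H : udim_ge A = udim_ge Rp by rewrite /udim /is_udim H.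
apply/funext => n; apply/propext; split=> [uA|[L [hL indL]]]; last first.
  exists (fun i f => A f /\ AL A (L i) f); split.
    by move=> i; have [iL nL] := hL i; split=> //; apply: nzAL.
  move=> v hv e i; apply: (@AL_indep _ _ _ _ _ _ _ sp _ (index_enum 'I_n) L _ _ A v) => //.
  - by move=> j _; case: (hL j).
  - by move=> w hw e' j _; apply: indL => // k; apply: hw; rewrite mem_index_enum.
  - by move=> j _; case: (hv j).
(* Otherwise [R] has some finite dimension [m < n], with an essential sum of [m] uniform left
   ideals. These give [m] independent uniform left ideals of [A], against [m + 1] independent
   ones. *)
apply: contrapT => /(udim_threshold)[m [mn um num]].
have [U [uU indU eU]] := udim_finite_uniform sR eu um num.
have [K [hK indK]] := udim_ge_mono mn uA.
have iU i : lideal Rp (U i) by case: (uU i).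
pose M i f := A f /\ AL A (U i) f.
have iM i : lideal A (M i) by exact: iAL.
have sumM := sumI_lideal sA iM.
(* Each [K j] is cut down to the sum of the [M i]; it stays non-zero because the sum of the [U i] is
   essential in [R]. *)
apply: (@goldie S A sA m M (fun j s => K j s /\ sumI M s)).
- by move=> i; apply: uniA.
- move=> v hv e i; apply: (@AL_indep _ _ _ _ _ _ _ sp _ (index_enum 'I_m) U _ _ A v) => //.
  + by move=> w hw e' j _; apply: indU => // k; apply: hw; rewrite mem_index_enum.
  + by move=> j _; case: (hv j).
- move=> j; have [iK [f [Kf f0]]] := hK j; split; first exact: lidealI.
  have [a Aa [n0 La]] := good_essential gA eU (lidealS iK Kf) f0.
  have [g hg e] : exists2 g, (forall i, AL A (U i) (g i)) & a * f = \sum_(i < m) g i.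
    elim/AL_ind: _ / La => [|b l h Ab [v hv ->] _ [g hg ->]].
      by exists (fun _ => 0); [move=> i; apply: AL_zero|rewrite big1].
    exists (fun i => b * v i + g i); first by move=> i; apply: AL_cons.
    by rewrite mulr_sumr big_split.
  have [|a' Aa' ha] := good_nice gA (E := a * f :: [seq g i | i <- enum 'I_m]).
    move=> s; rewrite inE => /orP[/eqP->|/mapP[i _ ->]].
      by apply: AL_mono La => // l; apply: lidealS; apply: sumI_lideal.
    by apply: AL_mono (hg i) => // l; apply: lidealS.
  have [_ n1] := ha (a * f) (mem_head _ _).
  exists (a' * (a * f)); split; last exact: n1.
  split; first by do 2?apply: (lidealM iK).
  exists (fun i => a' * g i); last by rewrite e mulr_sumr.
  move=> i; split; last exact: AL_mull.
  by have [] := ha (g i) _; rewrite // inE map_f ?orbT // mem_enum.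
- move=> v hv; apply: indK => j; by case: (hv j).
- by move=> j s [].
Qed.
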